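(* Let $0<\alpha<2$ and suppose $\{Y_t\}_{t\in T}$ is an $\alpha$-Fréchet process with extremal spectral representation $$\{Y_t\}_{t\in T}\stackrel{d}{=}\Big\{\int^{e}_S f_t(s)\,M^\vee_\alpha(\mathrm{d}s)\Big\}_{t\in T},$$ where $F=\{f_t\}_{t\in T}\subset L^\alpha_+(S,\mathcal{B}_S,\mu)$ has full support. Let $\{Y^{(k)}_t\}_{t\in T}$, $k=1,\dots,n$, be independent $\alpha$-Fréchet processes. Then the decomposition $$\{Y_t\}_{t\in T}\stackrel{d}{=}\{Y^{(1)}_t\vee\cdots\vee Y^{(n)}_t\}_{t\in T}$$ holds if and only if there exist measurable functions $r_k:S\to[0,1]$, $k=1,\dots,n$, such that $$\{Y^{(k)}_t\}_{t\in T}\stackrel{d}{=}\Big\{\int^{e}_S r_k(s)f_t(s)\,M^\vee_\alpha(\mathrm{d}s)\Big\}_{t\in T},\qquad k=1,\dots,n.\qquad(\mathrm{R})$$ In this case, $\sum_{k=1}^n r_k(s)^\alpha=1$, $\mu$-almost everywhere on $S$, and the $r_k$'s in (R) can be chosen to be $\rho(F)$-measurable, uniquely modulo $\mu$.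
   Context: A random variable $Z$ has an $\alpha$-Fréchet distribution if $\mathbb{P}(Z\le x)=\exp(-\sigma^\alpha x^{-\alpha})$ for all $x>0$, with some constant $\sigma>0$. A process $\{Y_t\}_{t\in T}$ is $\alpha$-Fréchet if all its max-linear combinations $\bigvee_{i=1}^m a_iY_{t_i}$, $m\in\mathbb{N}$, $a_i\ge0$, $t_i\in T$, are $\alpha$-Fréchet. The index set $T$ is a complete separable metric space, $\stackrel{d}{=}$ denotes equality of finite-dimensional distributions, and $\vee$ denotes maximum. $(S,\mathcal{B}_S,\mu)$ is a standard Lebesgue space with $\sigma$-finite measure $\mu$, and $L^\alpha_+(S,\mathcal{B}_S,\mu)=\{f\in L^\alpha(S,\mathcal{B}_S,\mu):f\ge0\}$. $M^\vee_\alpha$ is an $\alpha$-Fréchet random sup-measure with control measure $\mu$ and $\int^{e}$ is the extremal integral: for $\{g_t\}_{t\in T}\subset L^\alpha_+(S,\mathcal{B}_S,\mu)$, the finite-dimensional distributions of the process $W_t=\int^{e}_S g_t\,\mathrm{d}M^\vee_\alpha$ are given by $$\mathbb{P}(W_{t_i}\le y_i,\ i=1,\dots,m)=\exp\Big\{-\int_S\Big(\max_{1\le i\le m}\frac{g_{t_i}(s)}{y_i}\Big)^\alpha\mu(\mathrm{d}s)\Big\},\quad y_i>0,\ t_i\in T.$$ Full support means $S=\mathrm{supp}\{f_t,\ t\in T\}$, i.e. there is no $A\in\mathcal{B}_S$ with $\mu(A)>0$ such that for every $t\in T$, $f_t=0$ $\mu$-almost everywhere on $A$. The ratio $\sigma$-algebra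 of $F$ is $\rho(F)=\sigma\{f_{t_1}/f_{t_2}:\ t_1,t_2\in T\}$. Uniquely modulo $\mu$ means uniquely up to equality $\mu$-almost everywhere.
   Formalization: In the equivalence, the right-hand side also requires Σ r_k^α = 1 μ-a.e.; without it the ''if'' direction fails (n=1, r_1=1/2). The sum rule ''in this case'' is asserted for the ρ(F)-measurable r_k, since it can fail for other measurable solutions of (R). *)

(* Defs.v *)
From HB Require Import structures.
From mathcomp Require Import all_boot all_order all_algebra.
From mathcomp Require Import all_classical all_reals all_analysis.
From mathcomp Require Import measurable_realfun.

Set Implicit Arguments.
Unset Strict Implicit.
Unset Printing Implicit Defensive.

Import Order.TTheory GRing.Theory Num.Theory.
Import numFieldNormedType.Exports.

Local Open Scope classical_set_scope.
Local Open Scope ring_scope.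

(* metricType carries neither completeness nor a base point, and [cvg] needs
   the latter, hence the explicit limit. *)
Definition complete_separable (R : realType) (T : metricType R) : Prop :=
  (forall F : set_system T, ProperFilter F -> cauchy F ->
     exists x : T, F --> x) /\
  (exists D : set T, countable D /\ dense D).

Definition borel_set (R : realType) (E : metricType R) : set (set E) :=
  <<s open >>.

(* S is isomorphic, as a measurable space, to a Borel subset (the range of phi,
   with the trace sigma-algebra) of a complete separable metric space. *)
Definition standard_borel (R : realType) (d : measure_display)
    (S : measurableType d) : Prop :=
  exists (E : metricType R) (phi : S -> E),
    [/\ complete_separable E,
        injective phi,
        borel_set (range phi)
      & (measurable : set (set S)) =
        [set phi @^-1` B | B in @borel_set R E]].

(* Maximum of the nonempty family x_0, ..., x_m: starting the iteration at x_0
   avoids introducing a spurious neutral element. *)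
Definition vmax (R : realType) (m : nat) (x : 'I_m.+1 -> R) : R :=
  \big[Num.max/x ord0]_(i < m.+1) x i.

Section generated.
Context (d : measure_display) (U : measurableType d) (J S : Type).

(* The preimages that generate sigma{X_j : j in J}. *)
Definition family_gen (X : J -> S -> U) : set (set S) :=
  \bigcup_j preimage_set_system setT (X j) (@measurable d U).

Definition sigma_family (X : J -> S -> U) : set (set S) := <<s family_gen X >>.

End generated.

Section processes.
Context (R : realType).

Definition eq_fdd (T : Type)
    (d1 : measure_display) (O1 : measurableType d1) (P1 : probability O1 R)
    (X1 : T -> O1 -> R)
    (d2 : measure_display) (O2 : measurableType d2) (P2 : probability O2 R)
    (X2 : T -> O2 -> R) : Prop :=
  forall (m : nat) (t : m.-tuple T) (B : set (m.-tuple R)), measurable B ->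
    P1 [set w | B [tuple X1 (tnth t i) w | i < m]] =
    P2 [set w | B [tuple X2 (tnth t i) w | i < m]].

Context (d : measure_display) (O : measurableType d) (P : probability O R).

Definition is_frechet (alpha : R) (Z : O -> R) : Prop :=
  exists2 sigma : R, 0 < sigma &
    forall x : R, 0 < x ->
      P [set w | Z w <= x] =
      (expR (- (sigma `^ alpha * x `^ (- alpha))))%:E.

(* The coefficients are not all zero: the zero combination is identically 0,
   hence never Frechet with a scale sigma > 0. *)
Definition frechet_process (T : Type) (alpha : R) (Y : T -> O -> R) : Prop :=
  forall (m : nat) (t : 'I_m.+1 -> T) (a : 'I_m.+1 -> R),
    (forall i, 0 <= a i) -> (exists i, 0 < a i) ->
    is_frechet alpha (fun w => vmax (fun i => a i * Y (t i) w)).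

(* Mutual independence of finitely many processes, i.e. of the sigma-algebras
   they generate. Some of the A k may be the whole space, so the product rule
   over all of the indices entails the one over every subset of them. *)
Definition independent_processes (T : Type) (n : nat)
    (Y : 'I_n -> T -> O -> R) : Prop :=
  forall A : 'I_n -> set O, (forall k, sigma_family (Y k) (A k)) ->
    (P (\bigcap_k A k) = \prod_(k < n) P (A k))%E.

End processes.

Section extremal.
Context (R : realType) (d : measure_display) (S : measurableType d).
Context (mu : {measure set S -> \bar R}) (alpha : R).

Definition Lplus : set (S -> R) :=
  [set g | g \in Lfun mu alpha%:E /\ forall s, 0 <= g s].

(* I g stands for the extremal integral of g with respect to an alpha-Frechet
   random sup-measure M with control measure mu, defined on the probability
   space (O, P); M itself is A |-> I \1_A. Such an integral is specified by its
   finite-dimensional distributions. These are prescribed at y_i > 0, which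
   determines them because extremal integrals are nonnegative. *)
Definition is_extremal_integral (d' : measure_display) (O : measurableType d')
    (P : probability O R) (I : (S -> R) -> O -> R) : Prop :=
  (forall g, Lplus g ->
     measurable_fun setT (I g) /\ forall w, 0 <= I g w) /\
  (forall (m : nat) (g : 'I_m.+1 -> S -> R) (y : 'I_m.+1 -> R),
     (forall i, Lplus (g i)) -> (forall i, 0 < y i) ->
     P [set w | forall i, I (g i) w <= y i] =
     expeR (- \int[mu]_s (vmax (fun i => g i s / y i) `^ alpha)%:E)%E).

Context (T : Type) (f : T -> S -> R).

Definition full_support : Prop :=
  ~ exists A : set S, [/\ measurable A, (0 < mu A)%E &
      forall t, {ae mu, forall s, A s -> f t s = 0}].

(* The ratios are extended-real valued; with the conventions of \bar R,
   a / 0 = +oo for a > 0 and 0 / 0 = 0 * +oo = 0. *)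
Definition ratio (p : T * T) (s : S) : \bar R :=
  ((f p.1 s)%:E / (f p.2 s)%:E)%E.

Definition rho_measurable (r : S -> R) : Prop :=
  measurable_fun setT (r : g_sigma_algebraType (family_gen ratio) -> R).

End extremal.

(* Main.v *)
Require Import Defs.
From HB Require Import structures.
From mathcomp Require Import all_boot all_order all_algebra.
From mathcomp Require Import all_classical all_reals all_analysis.
From mathcomp Require Import measurable_realfun.
From mathcomp Require Import ring lra.
Import Order.TTheory GRing.Theory Num.Theory.
Import numFieldNormedType.Exports.
Local Open Scope classical_set_scope.
Local Open Scope ring_scope.

(** Write [phi t = f t `^ alpha].  A [form] is a finite list [H] of pairs
    (index, weight), and [maxlin H x] is the maximum of [0] and of the
    [u * x t] over the pairs [(t, u)] of [H].  The law of an alpha-Frechet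
    process [Z] is encoded by its exponent [l], defined on forms by
      P (Z_t ^ alpha <= 1 / u for all (t, u) in H) = exp (- l H),
    and the exponent of the extremal integral of [g] is the integral of
    [maxlin H (g ^ alpha)].  Exponents of independent processes add up when the
    maximum is taken.  So the decomposition means that the exponents [l k] of
    the components satisfy
      \sum_k l k H = \int maxlin H phi dmu  for all H,
    while (R) means that [l k H] is the integral of [maxlin H phi * r k ^ alpha].
    That (R) and the sum rule give the decomposition is then a computation; the
    converse asks to find densities for the [l k].

    An exponent is homogeneous and alternating: a combination of events
    [maxlin H_i x <= 1] that is nonnegative as a function of [x] has
    nonnegative expectation, and differentiating [exp (- z * l H_i)] at [z = 0]
    turns this into a sign for the same combination of the [l H_i]
    ([exponent_exists]).  These two properties and the sum formula suffice for
      \sum_i c_i * l k (H_i) <= \int (\sum_i c_i * maxlin H_i phi)^+ dmu,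
    which is [lin_le_pos], the heart of the proof.  It says that [l k] is a
    positive linear functional on the span of the functions [maxlin H phi],
    well defined and dominated by the integral; hence it extends by continuity
    to the L^1 closure of the span ([Lam] on [L1span]).

    The closure is large.  The right derivative at [v = 1] of
    [max (v * phi t, g)] is [phi t] on [{g <= phi t}] and [0] elsewhere, so the
    closure contains [phi t * \1_A] for [A] in a pi-system that generates the
    trace of rho(F) on [{f t > 0}], and then for every [A] in rho(F)
    ([L1span_ratio]).  Full support yields a countable subfamily without common
    zeros up to a null set, hence a weight [Phi > 0] a.e. such that
    [Phi * \1_A] lies in the closure for every [A] in rho(F) and the quotients
    [phi t / Phi] are rho(F)-measurable.  Thus [A |-> Lam k (Phi * \1_A)] is a
    measure on rho(F) below [Phi * mu]; its Radon-Nikodym density [h k] takes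
    its values in [[0, 1]] and is a density for [l k] ([density_exists]).  One
    takes [r k = h k `^ alpha^-1].

    The same closure gives uniqueness: two bounded rho(F)-measurable functions
    with equal integrals against all [maxlin H phi] have equal integrals against
    all [phi t * \1_A], so they agree a.e. by full support ([density_unique]).
    Applied to [\sum_k h k] and [1], this is the sum rule. *)

Set Implicit Arguments.
Unset Strict Implicit.
Unset Printing Implicit Defensive.

(** * Real-valued integrable functions *)

Section real_integrable.
Context (d : measure_display) (S : measurableType d) (R : realType).
Context (mu : {measure set S -> \bar R}) (D : set S) (mD : measurable D).
Implicit Types f g : S -> R.

Lemma integrable_add f g : mu.-integrable D (EFin \o f) ->
  mu.-integrable D (EFin \o g) -> mu.-integrable D (EFin \o (fun s => f s + g s)).
Proof. by move=> hf hg; exact: (integrableD mD hf hg). Qed.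

Lemma integrable_sub f g : mu.-integrable D (EFin \o f) ->
  mu.-integrable D (EFin \o g) -> mu.-integrable D (EFin \o (fun s => f s - g s)).
Proof. by move=> hf hg; exact: (integrableB mD hf hg). Qed.

Lemma integrable_scale z f : mu.-integrable D (EFin \o f) ->
  mu.-integrable D (EFin \o (fun s => z * f s)).
Proof. by move=> hf; exact: (integrableZl mD z hf). Qed.

Lemma integrable_dom f g : measurable_fun D f ->
  (forall s, D s -> `|f s| <= g s) -> mu.-integrable D (EFin \o g) ->
  mu.-integrable D (EFin \o f).
Proof.
move=> mf fg; apply: le_integrable => //; first exact/measurable_EFinP.
by move=> s Ds /=; rewrite lee_fin (le_trans (fg _ Ds))// ler_norm.
Qed.

Lemma integrable_normr f : mu.-integrable D (EFin \o f) ->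
  mu.-integrable D (EFin \o (fun s => `|f s|)).
Proof. by move=> hf; exact: (integrable_abse hf). Qed.

Lemma integrable_measurable f :
  mu.-integrable D (EFin \o f) -> measurable_fun D f.
Proof. by move=> /measurable_int /measurable_EFinP. Qed.

Lemma integrable_max f g : mu.-integrable D (EFin \o f) ->
  mu.-integrable D (EFin \o g) ->
  mu.-integrable D (EFin \o (fun s => Num.max (f s) (g s))).
Proof.
move=> hf hg; have hn := integrable_add (integrable_normr hf) (integrable_normr hg).
apply: integrable_dom hn.
  by apply: measurable_maxr; exact: integrable_measurable.
by move=> s _; rewrite maxEle; case: ifP => _; rewrite ?lerDl ?lerDr normr_ge0.
Qed.

End real_integrable.

(** * Max-linear forms and combinations of orthants *)

Section forms.
Context (R : realType) (T : Type).
Implicit Types (x : T -> R) (z : R).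

Definition form : Type := seq (T * R).
(** A combination stands for a signed sum of forms; [lin] evaluates it along any
    functional on forms: orthant indicators, max-linear values, or exponents. *)
Definition comb : Type := seq (R * form).

Definition maxlin (H : form) x : R := \big[Num.max/0]_(p <- H) (p.2 * x p.1).
Definition orth (H : form) x : bool := maxlin H x <= 1.
Definition dilate z (H : form) : form := [seq (p.1, z * p.2) | p <- H].
Definition lin (l : form -> R) (A : comb) : R := \sum_(p <- A) p.1 * l p.2.

(** Total mass [0] is what makes the condition insensitive to adding a constant
    to [l]: the sign of [l A] is that of minus the measure with
    [nu {x | ~~ orth H x} = l H], evaluated on the combination. *)
Definition alternating (l : form -> R) : Prop :=
  forall A, lin (fun=> 1) A = 0 ->
    (forall x, (forall t, 0 <= x t) -> 0 <= lin (fun H => (orth H x)%:R) A) ->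
    lin l A <= 0.

Lemma maxlin_nil x : maxlin [::] x = 0. Proof. by rewrite /maxlin big_nil. Qed.

Lemma maxlin_cons p H x : maxlin (p :: H) x = Num.max (p.2 * x p.1) (maxlin H x).
Proof. by rewrite /maxlin big_cons. Qed.

Lemma maxlin_ge0 H x : 0 <= maxlin H x.
Proof.
by elim: H => [|p H IH]; rewrite ?maxlin_nil // maxlin_cons le_max IH orbT.
Qed.

Lemma maxlin_cat H G x : maxlin (H ++ G) x = Num.max (maxlin H x) (maxlin G x).
Proof.
elim: H => [|p H IH]; first by rewrite maxlin_nil (max_idPr (maxlin_ge0 G x)).
by rewrite cat_cons !maxlin_cons IH maxA.
Qed.

Lemma maxlin_dilate z H x : 0 <= z -> maxlin (dilate z H) x = z * maxlin H x.
Proof.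
move=> z0; elim: H => [|p H IH]; first by rewrite !maxlin_nil mulr0.
by rewrite /= !maxlin_cons IH /= -mulrA maxr_pMr.
Qed.

Lemma maxlin_scale z H x : 0 <= z -> maxlin H (fun t => z * x t) = z * maxlin H x.
Proof.
move=> z0; elim: H => [|p H IH]; first by rewrite !maxlin_nil mulr0.
by rewrite /= !maxlin_cons IH /= mulrCA maxr_pMr.
Qed.

Lemma maxlin0 H : maxlin H (fun=> 0) = 0.
Proof. by elim: H => [|p H IH]; rewrite ?maxlin_nil // maxlin_cons IH mulr0 maxxx. Qed.

Lemma orth0 H : orth H (fun=> 0). Proof. by rewrite /orth maxlin0. Qed.

Lemma orth_nil x : orth [::] x. Proof. by rewrite /orth maxlin_nil. Qed.

Lemma orth_cat H G x : orth (H ++ G) x = orth H x && orth G x.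
Proof. by rewrite /orth maxlin_cat ge_max. Qed.

Lemma maxlin_ray H x w : 0 < w -> orth H (fun t => w^-1 * x t) = (maxlin H x <= w).
Proof.
move=> w0; rewrite /orth maxlin_scale; last by rewrite invr_ge0 ltW.
by rewrite ler_pdivrMl// mulr1.
Qed.

Lemma lin_nil l : lin l [::] = 0. Proof. by rewrite /lin big_nil. Qed.

Lemma lin_cons l p A : lin l (p :: A) = p.1 * l p.2 + lin l A.
Proof. by rewrite /lin big_cons. Qed.

Lemma lin_cat l A B : lin l (A ++ B) = lin l A + lin l B.
Proof. by rewrite /lin big_cat. Qed.

Definition scale_comb z (A : comb) : comb := [seq (z * p.1, p.2) | p <- A].

Lemma lin_scale_comb l z A : lin l (scale_comb z A) = z * lin l A.
Proof.
by rewrite /lin big_map mulr_sumr; apply: eq_bigr => p _; rewrite mulrA.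
Qed.

Lemma lin_flatten (I : Type) (s : seq I) (F : I -> comb) l :
  lin l (flatten [seq F i | i <- s]) = \sum_(i <- s) lin l (F i).
Proof.
elim: s => [|i s IH] /=; first by rewrite lin_nil big_nil.
by rewrite lin_cat big_cons IH.
Qed.

(** Orthant indicators are stable under products, since [orth (H ++ G)] is a
    conjunction.  So, splitting on the indicator of the first orthant, any
    function of a combination of them is again such a combination; this is
    what allows one to take positive parts. *)
Lemma lin_orth_comp (Theta : R -> R) (A : comb) : exists B : comb,
  forall x, lin (fun H => (orth H x)%:R) B =
            Theta (lin (fun H => (orth H x)%:R) A).
Proof.
elim: A Theta => [|[a H] A IH] Theta.
  exists [:: (Theta 0, [::])] => x.
  by rewrite lin_cons !lin_nil orth_nil mulr1 addr0.
have [B0 hB0] := IH Theta; have [B1 hB1] := IH (fun y => Theta (a + y)).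
pose r (B : comb) : comb := [seq (p.1, H ++ p.2) | p <- B].
have hr x B : lin (fun H => (orth H x)%:R) (r B) =
    (orth H x)%:R * lin (fun H => (orth H x)%:R) B.
  rewrite /lin big_map mulr_sumr; apply: eq_bigr => p _ /=.
  by rewrite orth_cat mulrCA -natrM mulnb.
exists (r B1 ++ scale_comb (-1) (r B0) ++ B0) => x.
rewrite !lin_cat lin_scale_comb !hr hB0 hB1 lin_cons /=.
case: orth; rewrite /= ?mulr1 ?mulr0 ?mul1r ?mul0r ?mulN1r ?add0r; first by ring.
by rewrite oppr0 add0r.
Qed.

Lemma integral_threshold (M v : R) : 0 <= v <= M ->
  let m := @lebesgue_measure R in
  m.-integrable `]0, M] (EFin \o (fun w => (v <= w)%R%:R : R)) /\
  \int[m]_(w in `]0, M]) (v <= w)%R%:R = M - v.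
Proof.
move=> /andP[v0 vM] m.
have E w : (v <= w)%R%:R = \1_(`[v, +oo[) w :> R.
  by by rewrite indicE mem_setE in_itv/= andbT.
have IE : `[v, +oo[%classic `&` `]0, M]%classic =
    [set` Interval (BSide (v != 0) v) (BRight M)].
  apply/seteqP; split=> w /=; rewrite !in_itv /= ?andbT.
    move=> [vw /andP[w0 ->]]; rewrite andbT.
    by case: eqP => //= ->.
  move=> /andP[vw ->]; rewrite andbT; move: vw.
  case: eqP => /= [->|/eqP vn0] vw; first by split=> //; exact: ltW.
  by split=> //; apply: lt_le_trans vw; rewrite lt_neqAle eq_sym vn0.
have mv : measurable `[v, +oo[%classic by exact: measurable_itv.
have mM' : measurable `]0, M]%classic by exact: measurable_itv.
have -> : (fun w => (v <= w)%R%:R) = \1_(`[v, +oo[) :> (R -> R) by exact/funext.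
have L : m [set` Interval (BSide (v != 0) v) (BRight M)] = (M - v)%:E.
  rewrite /m lebesgue_measure_itv/= lte_fin.
  by case: ltP => //= Mv; congr (_%:E); lra.
split.
  apply/integrableP; split.
    by apply/measurable_EFinP; exact: measurable_indic.
  under eq_integral do rewrite /= ger0_norm//.
  by rewrite integral_indic// IE [ltLHS]L ltry.
by rewrite /Rintegral integral_indic// IE [X in fine X]L.
Qed.

(** Integrate the hypothesis over [w] in [(0, M]] for a large [M]: the integral of
    the indicator of [v <= w] is [M - v], and the terms in [M] cancel since the
    total mass is [0].  This is the alternating property of the functional
    [maxlin ^~ x], tested along the single ray through [x]. *)
Lemma maxlin_layer x (A : comb) : lin (fun=> 1) A = 0 ->
  (forall w, 0 < w -> 0 <= lin (fun H => (maxlin H x <= w)%R%:R) A) ->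
  lin (fun H => maxlin H x) A <= 0.
Proof.
move=> A0 Age0.
pose m := @lebesgue_measure R.
pose M := \sum_(p <- A) maxlin p.2 x.
have M0 : 0 <= M by apply: sumr_ge0 => p _; exact: maxlin_ge0.
pose g (B : comb) w : R := lin (fun H => (maxlin H x <= w)%R%:R) B.
have key (B : comb) : \sum_(p <- B) maxlin p.2 x <= M ->
    m.-integrable `]0, M] (EFin \o g B) /\
    \int[m]_(w in `]0, M]) g B w = M * lin (fun=> 1) B - lin (fun H => maxlin H x) B.
  elim: B => [_|p B IH].
    have -> : g [::] = cst 0 by apply/funext => w; rewrite /g lin_nil.
    rewrite !lin_nil mulr0 subr0; split; first exact: integrable0.
    by rewrite /Rintegral integral0.
  rewrite big_cons => pB.
  have v0 := maxlin_ge0 p.2 x.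
  have B0 : 0 <= \sum_(p <- B) maxlin p.2 x by apply: sumr_ge0 => q _; exact: maxlin_ge0.
  have [|i1 e1] := @integral_threshold M (maxlin p.2 x); first by rewrite v0/=; lra.
  have [|i2 e2] := IH; first by lra.
  have -> : g (p :: B) = fun w => p.1 * (maxlin p.2 x <= w)%R%:R + g B w.
    by apply/funext => w; rewrite /g lin_cons.
  have i3 : m.-integrable `]0, M]
      (EFin \o (fun w => p.1 * (maxlin p.2 x <= w)%R%:R : R)).
    by apply: integrable_scale => //; exact: measurable_itv.
  split; first by apply: integrable_add => //; exact: measurable_itv.
  rewrite RintegralD// RintegralZl// e1 e2 !lin_cons /=; ring.
have [//|_] := key A.
rewrite A0 mulr0 sub0r => e.
rewrite -oppr_ge0 -e; apply: Rintegral_ge0 => w /=.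
by rewrite in_itv/= => /andP[w0 _]; exact: Age0.
Qed.

End forms.

(** * Alternating functionals and the window combination *)

Section window.
Context (R : realType) (T : eqType).
Implicit Types (x : T -> R) (z : R) (H F : form R T) (A B : comb R T).
Implicit Types (l : form R T -> R).

Definition homogeneous l : Prop :=
  forall z H, 0 < z -> l (dilate z H) = z * l H.

Lemma dilate_cat z H F : dilate z (H ++ F) = dilate z H ++ dilate z F.
Proof. exact: map_cat. Qed.

Lemma dilate_dilate a b H : dilate a (dilate b H) = dilate (a * b) H.
Proof. by rewrite /dilate -map_comp; apply: eq_map => p /=; rewrite mulrA. Qed.

(** Test the alternating property on the difference of two nested orthants. *)
Lemma alternating_mono l H F : alternating l ->
  (forall x, (forall t, 0 <= x t) -> orth F x -> orth H x) -> l H <= l F.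
Proof.
move=> al HF; rewrite -subr_le0.
have -> : l H - l F = lin l [:: (1, H); (-1, F)].
  by rewrite !lin_cons lin_nil /=; ring.
apply: al => [|x x0]; rewrite !lin_cons lin_nil /=; first by ring.
have := HF x x0; case: (orth F x) => [->//|_] /=; last first.
  by rewrite mulr0 !addr0 mul1r ler0n.
by rewrite addr0 mulr1 mulN1r subrr.
Qed.

Lemma alternating_nil l : homogeneous l -> l [::] = 0.
Proof.
move=> hl; have := hl 2 [::] ltac:(by rewrite ltr0n); rewrite /dilate /= => e.
by lra.
Qed.

Lemma alternating_ge0 l H : homogeneous l -> alternating l -> 0 <= l H.
Proof.
move=> hl al; rewrite -(alternating_nil hl); apply: alternating_mono => // x _ _.
exact: orth_nil.
Qed.

(** Test the alternating property on the product of the complements of two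
    orthants. *)
Lemma alternating_subadd l H F : homogeneous l -> alternating l ->
  l (H ++ F) <= l H + l F.
Proof.
move=> hl al; rewrite -subr_le0.
have -> : l (H ++ F) - (l H + l F) =
    lin l [:: (1, H ++ F); (-1, H); (-1, F); (1, [::])].
  by rewrite !lin_cons lin_nil /= (alternating_nil hl); ring.
apply: al => [|x x0]; rewrite !lin_cons lin_nil /=; first by ring.
rewrite orth_cat orth_nil.
by case: (orth H x); case: (orth F x) => /=; rewrite ?mulr0 ?mulr1; lra.
Qed.

(** For [y] in [[0, 1]] this rounds [y] up to the grid of the powers of [lam^-1],
    cut off at [lam ^- N].  It is written with the indicators of
    [lam ^+ n.+1 * y <= 1], so that it becomes a combination of orthants. *)
Definition gridq (lam : R) (N : nat) (y : R) : R :=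
  1 - \sum_(n <- iota 0 N) (lam - 1) * lam ^- n.+1 * (lam ^+ n.+1 * y <= 1)%R%:R.

Lemma gridqS lam N y : gridq lam N.+1 y =
  gridq lam N y - (lam - 1) * lam ^- N.+1 * (lam ^+ N.+1 * y <= 1)%R%:R.
Proof.
by rewrite /gridq -addn1 iotaD big_cat /= big_seq1 add0n addn1; ring.
Qed.

Lemma gridqP lam N y : 1 < lam -> 0 <= y <= 1 ->
  (y <= lam ^- N -> gridq lam N y = lam ^- N) /\
  (lam ^- N < y -> y <= gridq lam N y <= lam * y).
Proof.
move=> lam1 /andP[y0 y1]; have lam0 : 0 < lam by lra.
elim: N => [|N [IH1 IH2]].
  rewrite expr0 invr1; split; last by move=> y1'; exfalso; lra.
  by move=> _; rewrite /gridq /= big_nil subr0.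
have dN : lam ^- N = lam * lam ^- N.+1.
  by rewrite exprS invfM mulrA divff ?mul1r// gt_eqF.
have pN : 0 < lam ^- N.+1 by rewrite invr_gt0 exprn_gt0.
have -> : gridq lam N.+1 y =
    gridq lam N y - (lam - 1) * lam ^- N.+1 * (y <= lam ^- N.+1)%R%:R.
  by rewrite gridqS -ler_pdivlMl ?exprn_gt0// mulr1.
split=> hy.
  rewrite hy mulr1 IH1 dN; last by nra.
  by ring.
rewrite [y <= lam ^- N.+1]leNgt hy /= mulr0 subr0.
have [yN|yN] := leP y (lam ^- N); last exact: IH2.
by rewrite IH1// yN /= dN ler_pM2l// ltW.
Qed.

Lemma gridq_near lam N y : 1 < lam -> 0 <= y <= 1 ->
  `|gridq lam N y - y| <= (lam - 1) + lam ^- N.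
Proof.
move=> lam1 y01; have [h1 h2] := gridqP N lam1 y01.
have lam0 : 0 < lam by lra.
have pN : 0 < lam ^- N by rewrite invr_gt0 exprn_gt0.
case/andP: y01 => y0 y1.
have [yN|yN] := leP y (lam ^- N).
  by rewrite h1// ger0_norm; lra.
by case/andP: (h2 yN) => a b; rewrite ger0_norm; nra.
Qed.

(** As a function of [x] this is the indicator of the window
    [lam^-1 < maxlin F0 x <= 1], times the value of [gridq] at [maxlin F x]: each
    indicator in [gridq] is an orthant of a dilation of [F]. *)
Definition window (lam : R) (N : nat) (F0 F : form R T) : comb R T :=
  [:: (1, F0); (-1, dilate lam F0)] ++
  flatten [seq [:: (- ((lam - 1) * lam ^- n.+1), F0 ++ dilate (lam ^+ n.+1) F);
                   ((lam - 1) * lam ^- n.+1, dilate lam F0 ++ dilate (lam ^+ n.+1) F)]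
          | n <- iota 0 N].

Lemma lin_window l lam N F0 F : lin l (window lam N F0 F) =
  l F0 - l (dilate lam F0) -
  \sum_(n <- iota 0 N) (lam - 1) * lam ^- n.+1 *
    (l (F0 ++ dilate (lam ^+ n.+1) F) - l (dilate lam F0 ++ dilate (lam ^+ n.+1) F)).
Proof.
rewrite lin_cat lin_flatten !lin_cons lin_nil /=.
rewrite -sumrN; congr (_ + _); first by ring.
by apply: eq_bigr => n _; rewrite !lin_cons lin_nil /=; ring.
Qed.

Lemma lin_window_orth lam N F0 F x :
  lin (fun H => (orth H x)%:R) (window lam N F0 F) =
  ((orth F0 x)%:R - (orth (dilate lam F0) x)%:R) *
  (1 - \sum_(n <- iota 0 N) (lam - 1) * lam ^- n.+1 *
     (orth (dilate (lam ^+ n.+1) F) x)%:R).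
Proof.
rewrite lin_window mulrBr mulr1; congr (_ - _).
rewrite mulr_sumr; apply: eq_bigr => n _.
by rewrite !orth_cat -!mulnb !natrM; ring.
Qed.

(** Dilation by the powers of [lam] makes the sum telescope.  The coefficients of
    [gridq] were chosen for this: an alternating homogeneous functional takes on
    the window combination, exactly and not up to an error, a multiple of its
    value at [F], slightly enlarged by a small multiple of [F0]. *)
Lemma lin_window_alternating l lam N F0 F : 1 < lam ->
  homogeneous l -> alternating l ->
  (forall x, (forall t, 0 <= x t) -> orth F0 x -> orth F x) ->
  lin l (window lam N F0 F) = - (lam - 1) * l (dilate (lam ^- N) F0 ++ F).
Proof.
move=> lam1 hl al F0F; have lam0 : 0 < lam by lra.
have e0 : l (F0 ++ F) = l F0.
  apply/le_anti/andP; split; apply: alternating_mono => // x x0.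
    by move=> h; rewrite orth_cat h F0F.
  by rewrite orth_cat => /andP[].
pose a n := l (dilate (lam ^- n) F0 ++ F).
have ha n : l (F0 ++ dilate (lam ^+ n) F) = lam ^+ n * a n.
  rewrite -hl ?exprn_gt0// dilate_cat dilate_dilate divff ?gt_eqF ?exprn_gt0//.
  by congr (l (_ ++ _)); rewrite /dilate -[LHS]map_id; apply: eq_map => -[? ?] /=;
    rewrite mul1r.
have hb n : l (dilate lam F0 ++ dilate (lam ^+ n.+1) F) = lam ^+ n.+1 * a n.
  rewrite -hl ?exprn_gt0// dilate_cat dilate_dilate; congr (l (dilate _ _ ++ _)).
  by rewrite exprS -mulrA divff ?mulr1// gt_eqF// exprn_gt0.
rewrite lin_window hl// -/(a N).
have -> : \sum_(n <- iota 0 N) (lam - 1) * lam ^- n.+1 *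
    (l (F0 ++ dilate (lam ^+ n.+1) F) - l (dilate lam F0 ++ dilate (lam ^+ n.+1) F)) =
    (lam - 1) * (a N - a 0%N).
  elim: N => [|N IH]; first by rewrite big_nil subrr mulr0.
  rewrite -addn1 iotaD big_cat /= big_seq1 IH add0n ha hb addn1.
  have : lam ^- N.+1 * lam ^+ N.+1 = 1 by rewrite mulVf// gt_eqF// exprn_gt0.
  move=> e; transitivity ((lam - 1) * (a N - a 0%N) +
     (lam - 1) * (lam ^- N.+1 * lam ^+ N.+1) * (a N.+1 - a N)); first by ring.
  by rewrite e; ring.
have -> : a 0%N = l F0.
  rewrite /a expr0 invr1 -e0; congr (l (_ ++ _)).
  by rewrite /dilate -[RHS]map_id; apply: eq_map => -[? ?] /=; rewrite mul1r.
by ring.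
Qed.

Lemma window_ray lam N F0 F x (w : R) : 1 < lam -> 0 < w -> maxlin F x <= maxlin F0 x ->
  lin (fun H => (orth H (fun t => w^-1 * x t))%:R) (window lam N F0 F) =
  (maxlin F0 x <= w < lam * maxlin F0 x)%R%:R * gridq lam N (maxlin F x / w).
Proof.
move=> lam1 w0 FF0; have lam0 : 0 < lam by lra.
rewrite lin_window_orth !maxlin_ray// (maxlin_dilate _ _ (ltW lam0)); congr (_ * _).
  case: (leP (maxlin F0 x) w) => h1 /=; case: (leP (lam * maxlin F0 x) w) => h2 /=;
    rewrite ?subrr ?subr0 ?sub0r ?oppr0 //.
  by have := maxlin_ge0 F0 x; nra.
rewrite /gridq; congr (1 - _); apply: eq_bigr => n _; congr (_ * _).
by rewrite maxlin_ray// maxlin_dilate ?exprn_ge0 ?(ltW lam0)// mulrA ler_pdivrMr// mul1r.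
Qed.

Lemma maxlin_flatten (A : comb R T) x p : p \in A ->
  maxlin p.2 x <= maxlin (flatten [seq q.2 | q <- A]) x.
Proof.
elim: A => //= q A IH; rewrite inE => /orP[/eqP->|/IH h]; rewrite maxlin_cat le_max ?lexx//.
by rewrite h orbT.
Qed.

(** The combination [B] is the positive part of the window combination of [A],
    where [F0] collects all the forms of [A].  Since [B] is above that combination,
    alternation bounds [lin l A] (up to the perturbation by [F0]) by [- lin l B].
    On the other hand [- lin l B] is computable for [l = maxlin ^~ x]: on the ray
    of the points [x / w], the window is the set of [w] between [maxlin F0 x] and
    [lam * maxlin F0 x], where rounding moves each [maxlin F x / w] by at most
    [lam - 1 + lam ^- N], and [maxlin_layer] integrates over [w]. *)
Lemma window_majorant (A : comb R T) lam N : 1 < lam ->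
  let F0 := flatten [seq p.2 | p <- A] in
  exists B : comb R T, [/\ lin (fun=> 1) B = 0,
    (forall x, 0 <= lin (fun H => (orth H x)%:R) B),
    (forall l, homogeneous l -> alternating l ->
      (lam - 1) * lin (fun F => l (dilate (lam ^- N) F0 ++ F)) A <= - lin l B) &
    (forall x, - lin (fun H => maxlin H x) B <= (lam - 1) * (Num.max (lin (fun H => maxlin H x) A) 0 +
       (\sum_(p <- A) `|p.1|) * ((lam - 1) + lam ^- N) * maxlin F0 x))].
Proof.
move=> lam1 F0; have lam0 : 0 < lam by lra.
pose A1 : comb R T := flatten [seq scale_comb p.1 (window lam N F0 p.2) | p <- A].
have [B hB] := lin_orth_comp (fun y => Num.max y 0) A1.
exists B.
have lin10 C : lin (fun=> 1) C = lin (fun H => (orth H (fun=> 0))%:R) C.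
  by congr lin; apply/funext => H; rewrite orth0.
have A10 : lin (fun=> 1) A1 = 0.
  rewrite lin_flatten big1// => p _; rewrite lin_scale_comb lin_window big1 ?subr0.
    by rewrite subrr mulr0.
  by move=> n _; rewrite subrr mulr0.
have B0 : lin (fun=> 1) B = 0 by rewrite lin10 hB -lin10 A10 maxxx.
split => //.
- by move=> x; rewrite hB le_max lexx orbT.
- move=> l hl al.
  have <- : - lin l A1 = (lam - 1) * lin (fun F => l (dilate (lam ^- N) F0 ++ F)) A.
    rewrite lin_flatten /lin mulr_sumr -sumrN big_seq [RHS]big_seq.
    apply: eq_bigr => p pA; rewrite -/(lin _ _) lin_scale_comb.
    rewrite lin_window_alternating//; first by ring.
    by move=> x _; apply: le_trans; exact: maxlin_flatten.
  rewrite lerN2 -subr_le0.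
  have -> : lin l B - lin l A1 = lin l (B ++ scale_comb (-1) A1).
    by rewrite lin_cat lin_scale_comb mulN1r.
  apply: al => [|x _]; rewrite lin_cat lin_scale_comb ?B0 ?A10 ?mulr0 ?addr0//.
  by rewrite hB mulN1r subr_ge0 le_max lexx.
move=> x; set v0 := maxlin F0 x; set C := \sum_(p <- A) _.
set d := _ + lam ^- N.
have d0 : 0 <= d by rewrite addr_ge0 ?invr_ge0 ?exprn_ge0; lra.
have C0 : 0 <= C by apply: sumr_ge0.
have v00 : 0 <= v0 by exact: maxlin_ge0.
set m := Num.max _ 0.
have m0 : 0 <= m by rewrite le_max lexx orbT.
(* [M] bounds the rounded combination on the window of the ray; [D] is then
   nonnegative along the whole ray. *)
pose M := m / v0 + C * d.
have M0 : 0 <= M by rewrite addr_ge0 ?mulr_ge0 ?invr_ge0.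
pose D : comb R T := [:: (M, F0); (- M, dilate lam F0)] ++ scale_comb (-1) B.
have : lin (fun H => maxlin H x) D <= 0.
  apply: maxlin_layer.
    by rewrite lin_cat lin_scale_comb B0 !lin_cons lin_nil /=; ring.
  move=> w w0; rewrite lin_cat lin_scale_comb !lin_cons lin_nil /= addr0.
  have -> : (fun H => (maxlin H x <= w)%R%:R) =
            (fun H => (orth H (fun t => w^-1 * x t))%:R : R).
    by apply/funext => H; rewrite maxlin_ray.
  rewrite hB (maxlin_dilate _ _ (ltW lam0)) -/v0 mulN1r mulNr.
  have -> : lin (fun H => (orth H (fun t => w^-1 * x t))%:R) A1 =
      (v0 <= w < lam * v0)%R%:R * \sum_(p <- A) p.1 * gridq lam N (maxlin p.2 x / w).
    rewrite lin_flatten mulr_sumr big_seq [RHS]big_seq; apply: eq_bigr => p pA.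
    rewrite lin_scale_comb window_ray//; last exact: maxlin_flatten.
    by rewrite mulrCA.
  have [vw|wv] /= := leP v0 w; last first.
    have -> : (lam * v0 <= w) = false by apply/negbTE; rewrite -ltNge; nra.
    by rewrite mul0r maxxx !mulr0 !subr0.
  have [lvw|wlv] /= := leP (lam * v0) w.
    by rewrite mul0r maxxx !mulr1 !subrr.
  rewrite mulr1 mulr0 subr0 mul1r subr_ge0 ge_max M0 andbT.
  have v0p : 0 < v0 by nra.
  have h1 : \sum_(p <- A) p.1 * gridq lam N (maxlin p.2 x / w) <=
      \sum_(p <- A) p.1 * maxlin p.2 x / w + C * d.
    rewrite /C mulr_suml -big_split /= big_seq [leRHS]big_seq; apply: ler_sum => p pA.
    have pv : 0 <= maxlin p.2 x / w <= 1.
      rewrite divr_ge0 ?maxlin_ge0 ?(ltW w0)//= ler_pdivrMr// mul1r.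
      exact: le_trans (maxlin_flatten _ pA) vw.
    have := gridq_near N lam1 pv; rewrite -/d => hq.
    rewrite -lerBlDl -mulrA -mulrBr; apply: le_trans (ler_norm _) _.
    by rewrite normrM ler_wpM2l.
  apply: le_trans h1 _; rewrite lerD2r -mulr_suml.
  have : lin (fun H => maxlin H x) A <= m by rewrite le_max lexx.
  rewrite /lin => h; apply: le_trans (_ : m / w <= _).
    by rewrite ler_wpM2r ?invr_ge0 ?(ltW w0).
  by rewrite ler_wpM2l ?lef_pV2.
rewrite lin_cat lin_scale_comb !lin_cons lin_nil /= (maxlin_dilate _ _ (ltW lam0)) -/v0 => h.
have h2 : M * v0 <= m + C * d * v0.
  rewrite /M mulrDl lerD2r -mulrA.
  have [->|v0n] := eqVneq v0 0; first by rewrite !mulr0.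
  by rewrite mulVf// mulr1.
have h3 : (lam - 1) * (M * v0) <= (lam - 1) * (m + C * d * v0).
  by rewrite ler_wpM2l//; lra.
by apply: le_trans h3; lra.
Qed.

End window.

(** * Domination and extension by continuity *)

Lemma exprV_archi (R : realType) (lam e : R) : 1 < lam -> 0 < e ->
  exists N, lam ^- N <= e.
Proof.
move=> lam1 e0; have lam0 : 0 < lam by lra.
have bern N : 1 + N%:R * (lam - 1) <= lam ^+ N.
  elim: N => [|N IH]; first by rewrite expr0 mul0r addr0.
  rewrite exprS -natr1; apply: le_trans (ler_wpM2l (ltW lam0) IH).
  have : 0 <= N%:R * (lam - 1) ^+ 2 by rewrite mulr_ge0// sqr_ge0.
  by rewrite expr2 => ?; lra.
have b0 : 0 <= e^-1 / (lam - 1) by apply: mulr_ge0; rewrite invr_ge0; lra.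
exists (Num.bound (e^-1 / (lam - 1))).
set N := Num.bound _.
have : e^-1 / (lam - 1) < N%:R by exact: archi_boundP.
rewrite ltr_pdivrMr; last by lra.
move=> h; rewrite -[leRHS]invrK lef_pV2 ?posrE ?invr_gt0 ?exprn_gt0//.
by have := bern N; lra.
Qed.

(** The form in which errors of order epsilon are discarded below. *)
Lemma le_of_eps (R : realType) (a b C : R) : 0 <= C ->
  (forall e, 0 < e -> a <= b + C * e) -> a <= b.
Proof.
move=> C0 h; apply/ler_addgt0Pr => e e0.
have C1 : 0 < C + 1 by lra.
apply: le_trans (h (e / (C + 1)) _) _; first exact: divr_gt0.
rewrite lerD2l mulrCA -[leRHS]mulr1 ler_wpM2l ?(ltW e0)//.
by rewrite ler_pdivrMr//; lra.
Qed.

Section closure.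
Context (R : realType) (T : eqType) (d : measure_display) (S : measurableType d).
Context (mu : {measure set S -> \bar R}) (phi : T -> S -> R).
Context (iphi : forall t, mu.-integrable setT (EFin \o phi t)).
Context (phi0 : forall t s, 0 <= phi t s).

Local Notation intg g := (mu.-integrable setT (EFin \o g)).
Local Notation Int g := (Rintegral mu setT g).
Implicit Types (g h : S -> R) (A B : comb R T) (H F : form R T).

Definition maxlin_fun H : S -> R := fun s => maxlin H (fun t => phi t s).
Definition vcomb A : S -> R := fun s => lin (fun H => maxlin_fun H s) A.

Lemma integrable_maxlin_fun H : intg (maxlin_fun H).
Proof.
elim: H => [|p H IH].
  rewrite (_ : maxlin_fun [::] = cst 0); first exact: integrable0.
  by apply/funext => s; rewrite /maxlin_fun maxlin_nil.
rewrite (_ : maxlin_fun _ = fun s => Num.max (p.2 * phi p.1 s) (maxlin_fun H s)).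
  by apply: integrable_max => //; exact: integrable_scale.
by apply/funext => s; rewrite /maxlin_fun maxlin_cons.
Qed.

Lemma integrable_vcomb A : intg (vcomb A).
Proof.
elim: A => [|p A IH].
  rewrite (_ : vcomb [::] = cst 0); first exact: integrable0.
  by apply/funext => s; rewrite /vcomb lin_nil.
rewrite (_ : vcomb _ = fun s => p.1 * maxlin_fun p.2 s + vcomb A s).
  apply: integrable_add => //; apply: integrable_scale => //.
  exact: integrable_maxlin_fun.
by apply/funext => s; rewrite /vcomb lin_cons.
Qed.

Lemma Int_vcomb A : Int (vcomb A) = lin (fun H => Int (maxlin_fun H)) A.
Proof.
elim: A => [|p A IH].
  rewrite lin_nil (_ : vcomb [::] = cst 0); first by rewrite /Rintegral integral0.
  by apply/funext => s; rewrite /vcomb lin_nil.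
rewrite (_ : vcomb _ = fun s => p.1 * maxlin_fun p.2 s + vcomb A s).
  rewrite RintegralD ?RintegralZl ?lin_cons ?IH//.
  - exact: integrable_maxlin_fun.
  - by apply: integrable_scale => //; exact: integrable_maxlin_fun.
  - exact: integrable_vcomb.
by apply/funext => s; rewrite /vcomb lin_cons.
Qed.

Lemma vcomb_cat A B s : vcomb (A ++ B) s = vcomb A s + vcomb B s.
Proof. exact: lin_cat. Qed.

Lemma vcomb_scale_comb z A s : vcomb (scale_comb z A) s = z * vcomb A s.
Proof. exact: lin_scale_comb. Qed.

Context (n : nat) (l : 'I_n.+1 -> form R T -> R).
Context (hl : forall k, homogeneous (l k)) (al : forall k, alternating (l k)).
Context (suml : forall H, \sum_k l k H = Int (maxlin_fun H)).

Lemma le_total k H : l k H <= Int (maxlin_fun H).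
Proof.
rewrite -suml (bigD1 k)//= lerDl; apply: sumr_ge0 => j _.
exact: alternating_ge0.
Qed.

Lemma integrable_pos g : intg g -> intg (fun s => Num.max (g s) 0).
Proof. by move=> ig; apply: integrable_max => //; exact: integrable0. Qed.

(** Take [B] from [window_majorant].  Every [- lin (l j) B] is nonnegative, so the
    one for [k] is at most their sum, which is minus an integral of
    combinations of max-linear functions and is bounded pointwise; then the mesh
    of the grid tends to [0]. *)
Lemma lin_le_pos k A : lin (l k) A <= Int (fun s => Num.max (vcomb A s) 0).
Proof.
pose F0 := flatten [seq p.2 | p <- A].
pose C := \sum_(p <- A) `|p.1|.
have C0 : 0 <= C by apply: sumr_ge0.
have K0 : 0 <= Int (maxlin_fun F0).
  by apply: Rintegral_ge0 => s _; exact: maxlin_ge0.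
apply: (@le_of_eps _ _ _ (3 * C * Int (maxlin_fun F0))).
  by rewrite !mulr_ge0.
move=> e e0; have lam1 : 1 < 1 + e by lra.
have [N hN] := exprV_archi lam1 e0.
have [B [B0 Bpos hB1 hB2]] := window_majorant A N lam1.
set dl := (1 + e) ^- N in hN hB1 hB2.
have dl0 : 0 < dl by rewrite invr_gt0 exprn_gt0//; lra.
have ee : 1 + e - 1 = e by lra.
rewrite -/F0 -/C ee in hB1 hB2.
have step1 : e * lin (fun F => l k (dilate dl F0 ++ F)) A <= - lin (l k) B.
  exact: hB1.
have step2 : - lin (l k) B <= - Int (vcomb B).
  rewrite Int_vcomb (_ : (fun H => Int (maxlin_fun H)) = fun H => \sum_j l j H);
    last by apply/funext => H; rewrite suml.
  have -> : lin (fun H => \sum_j l j H) B = \sum_j lin (l j) B.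
    by rewrite /lin exchange_big; apply: eq_bigr => p _; rewrite mulr_sumr.
  rewrite (bigD1 k)//= opprD lerDl oppr_ge0; apply: sumr_le0 => j _.
  exact: al.
have im := integrable_pos (integrable_vcomb A).
have iv := integrable_maxlin_fun F0.
have step3 : - Int (vcomb B) <= e * (Int (fun s => Num.max (vcomb A s) 0) +
    C * (e + dl) * Int (maxlin_fun F0)).
  rewrite -mulN1r -RintegralZl//; last exact: integrable_vcomb.
  rewrite -(RintegralZl (C * (e + dl)))// -RintegralD//; last exact: integrable_scale.
  rewrite -(RintegralZl e)//; last first.
    by apply: integrable_add => //; exact: integrable_scale.
  apply: le_Rintegral => //.
  - by apply: integrable_scale => //; exact: integrable_vcomb.
  - apply: integrable_scale => //; apply: integrable_add => //.
    exact: integrable_scale.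
  - by move=> s _; rewrite mulN1r; exact: hB2.
have step4 : lin (fun F => l k (dilate dl F0 ++ F)) A <=
    Int (fun s => Num.max (vcomb A s) 0) + C * (e + dl) * Int (maxlin_fun F0).
  rewrite -(ler_pM2l e0).
  by apply: le_trans step1 _; apply: le_trans step2 _.
have step5 : lin (l k) A - lin (fun F => l k (dilate dl F0 ++ F)) A <=
    C * dl * Int (maxlin_fun F0).
  rewrite -mulrA {1 2}/lin -sumrB /C mulr_suml; apply: ler_sum => p _.
  rewrite -mulrBr; apply: le_trans (ler_norm _) _; rewrite normrM ler_wpM2l//.
  rewrite ler0_norm ?opprB; last first.
    rewrite subr_le0; apply: alternating_mono => // x _.
    by rewrite orth_cat => /andP[].
  rewrite lerBlDr; apply: le_trans (alternating_subadd _ _ (hl k) (al k)) _.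
  rewrite lerD2r hl// ler_wpM2l ?(ltW dl0)//.
  exact: le_total.
have h1 : C * dl * Int (maxlin_fun F0) <= C * e * Int (maxlin_fun F0).
  by rewrite ler_wpM2r// ler_wpM2l.
have h2 : C * (e + dl) * Int (maxlin_fun F0) <= C * (e + e) * Int (maxlin_fun F0).
  by rewrite ler_wpM2r// ler_wpM2l// lerD2l.
have -> : 3 * C * Int (maxlin_fun F0) * e =
  C * (e + e) * Int (maxlin_fun F0) + C * e * Int (maxlin_fun F0) by ring.
lra.
Qed.

Lemma lin_le_norm k A B : lin (l k) A - lin (l k) B <=
  Int (fun s => `|vcomb A s - vcomb B s|).
Proof.
rewrite -[X in _ - X]mul1r -mulNr -lin_scale_comb -lin_cat.
apply: le_trans (lin_le_pos k _) _; apply: le_Rintegral => //.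
- by apply: integrable_pos; exact: integrable_vcomb.
- by apply: integrable_normr; apply: integrable_sub => //; exact: integrable_vcomb.
move=> s _; rewrite vcomb_cat vcomb_scale_comb mulN1r ge_max normr_ge0 andbT.
exact: ler_norm.
Qed.

Definition L1dist g h : R := Int (fun s => `|g s - h s|).

Lemma integrable_dist g h : intg g -> intg h -> intg (fun s => `|g s - h s|).
Proof. by move=> ig ih; apply: integrable_normr; exact: integrable_sub. Qed.

Lemma L1dist_triangle g h f : intg g -> intg h -> intg f ->
  L1dist g h <= L1dist g f + L1dist f h.
Proof.
move=> ig ih jf; rewrite /L1dist -RintegralD//; try exact: integrable_dist.
apply: le_Rintegral => //; try exact: integrable_dist.
  by apply: integrable_add => //; exact: integrable_dist.
by move=> s _; rewrite ler_distD.
Qed.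

Lemma L1distC g h : L1dist g h = L1dist h g.
Proof. by rewrite /L1dist; congr Rintegral; apply/funext => s; rewrite distrC. Qed.

Lemma L1dist_ge0 g h : 0 <= L1dist g h.
Proof. by apply: Rintegral_ge0. Qed.

(** For each [A], [lin_le_norm] forces any continuous extension of [l k] to be at
    least [lin (l k) A - L1dist g (vcomb A)] at [g]; the supremum of these lower
    bounds is the extension ([Lam_near]), on the closure of the span. *)
Definition Lam k g : R := sup [set lin (l k) A - L1dist g (vcomb A) | A in setT].

Lemma Lam_near k g A : intg g -> `|Lam k g - lin (l k) A| <= L1dist g (vcomb A).
Proof.
move=> ig.
have ub B : lin (l k) B - L1dist g (vcomb B) <= lin (l k) A + L1dist g (vcomb A).
  have := lin_le_norm k B A; rewrite -/(L1dist _ _).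
  have := L1dist_triangle (integrable_vcomb B) (integrable_vcomb A) ig.
  by rewrite (L1distC _ g); lra.
rewrite ler_distl; apply/andP; split.
  apply: ub_le_sup; last by exists A.
  by exists (lin (l k) A + L1dist g (vcomb A)) => _ [B _ <-].
apply: ge_sup; first by exists (lin (l k) A - L1dist g (vcomb A)), A.
by move=> _ [B _ <-].
Qed.

Definition L1span g : Prop :=
  intg g /\ forall e, 0 < e -> exists A, L1dist g (vcomb A) <= e.

Lemma L1dist_self g : L1dist g g = 0.
Proof.
rewrite /L1dist (_ : (fun s => _) = cst 0) ?/Rintegral ?integral0//.
by apply/funext => s; rewrite subrr normr0.
Qed.

Lemma L1span_vcomb A : L1span (vcomb A).
Proof.
split; first exact: integrable_vcomb.
by move=> e e0; exists A; rewrite L1dist_self ltW.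
Qed.

Lemma L1dist_add g g' h h' : intg g -> intg g' -> intg h -> intg h' ->
  L1dist (fun s => g s + h s) (fun s => g' s + h' s) <= L1dist g g' + L1dist h h'.
Proof.
move=> ig ig' ih ih'.
rewrite /L1dist -RintegralD//; try exact: integrable_dist.
apply: le_Rintegral => //.
- by apply: integrable_dist; exact: integrable_add.
- by apply: integrable_add => //; exact: integrable_dist.
by move=> s _; rewrite opprD addrACA ler_normD.
Qed.

Lemma L1dist_scale z g h : intg g -> intg h ->
  L1dist (fun s => z * g s) (fun s => z * h s) = `|z| * L1dist g h.
Proof.
move=> ig ih; rewrite /L1dist -RintegralZl//; last exact: integrable_dist.
by congr Rintegral; apply/funext => s; rewrite -mulrBr normrM.
Qed.

Lemma vcomb_catE A B : vcomb (A ++ B) = fun s => vcomb A s + vcomb B s.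
Proof. by apply/funext => s; exact: vcomb_cat. Qed.

Lemma vcomb_scale_combE z A : vcomb (scale_comb z A) = fun s => z * vcomb A s.
Proof. by apply/funext => s; exact: vcomb_scale_comb. Qed.

Lemma L1span_add g h : L1span g -> L1span h -> L1span (fun s => g s + h s).
Proof.
move=> [ig hg] [ih hh]; split; first exact: integrable_add.
move=> e e0; have e20 : 0 < e / 2 by lra.
have [A hA] := hg _ e20; have [B hB] := hh _ e20; exists (A ++ B).
rewrite vcomb_catE; apply: le_trans (L1dist_add _ _ _ _) _ => //;
  try exact: integrable_vcomb.
lra.
Qed.

Lemma L1span_scale z g : L1span g -> L1span (fun s => z * g s).
Proof.
move=> [ig hg]; split; first exact: integrable_scale.
move=> e e0; have z0 : 0 <= `|z| by [].
have z1 : 0 < `|z| + 1 by lra.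
have [A hA] := hg (e / (`|z| + 1)) (divr_gt0 e0 z1); exists (scale_comb z A).
rewrite vcomb_scale_combE L1dist_scale//; last exact: integrable_vcomb.
apply: le_trans (_ : (`|z| + 1) * (e / (`|z| + 1)) <= e); last first.
  by rewrite mulrCA divff ?mulr1// gt_eqF.
have := L1dist_ge0 g (vcomb A).
by move=> ?; apply: ler_pM => //; lra.
Qed.

Lemma L1span_sub g h : L1span g -> L1span h -> L1span (fun s => g s - h s).
Proof.
move=> hg hh; rewrite (_ : (fun s => _) = fun s => g s + (-1) * h s).
  by apply: L1span_add => //; exact: L1span_scale.
by apply/funext => s; rewrite mulN1r.
Qed.

Lemma L1span_closed g : intg g ->
  (forall e, 0 < e -> exists2 h, L1span h & L1dist g h <= e) -> L1span g.
Proof.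
move=> ig H; split=> // e e0; have e20 : 0 < e / 2 by lra.
have [h [ih hh] gh] := H _ e20; have [A hA] := hh _ e20; exists A.
apply: le_trans (L1dist_triangle _ _ ih) _ => //; first exact: integrable_vcomb.
lra.
Qed.

Lemma L1_dct (g : S -> R) (F : nat -> S -> R) (G : S -> R) :
  intg G -> (forall n, measurable_fun setT (F n)) ->
  (forall n s, `|F n s| <= G s) -> (forall s, F ^~ s @ \oo --> g s) ->
  intg g /\ L1dist (F n) g @[n --> \oo] --> 0.
Proof.
move=> iG mF FG Fg.
have mg : measurable_fun setT g.
  by apply: (measurable_fun_cvg (h := F)) => // s _; exact: Fg.
have [||||ig cv _] := @dominated_convergence _ _ _ mu setT measurableT
  (fun n => EFin \o F n) (EFin \o g) (EFin \o G) _ _ _ iG.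
- by move=> ?; apply/measurable_EFinP.
- exact/measurable_EFinP.
- by apply: aeW => s _ /=; apply: cvg_EFin; [exact: nearW|exact: Fg].
- by apply: aeW => s ? _ /=; rewrite lee_fin.
by split => //; move/fine_cvgP: cv => [].
Qed.

Lemma L1span_dct (g : S -> R) (F : nat -> S -> R) (G : S -> R) :
  intg G -> (forall n, L1span (F n)) ->
  (forall n s, `|F n s| <= G s) -> (forall s, F ^~ s @ \oo --> g s) ->
  L1span g.
Proof.
move=> iG hF FG Fg.
have mF m : measurable_fun setT (F m).
  by have [iF _] := hF m; exact: integrable_measurable iF.
have [ig cv] := L1_dct iG mF FG Fg.
apply: L1span_closed => // e e0.
move/cvgrPdist_le: cv => /(_ e e0) [N _ /(_ N (leqnn N)) /=].
rewrite sub0r normrN => hN; exists (F N) => //; rewrite L1distC.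
by apply: le_trans hN; exact: ler_norm.
Qed.

Lemma Lam_add k g h : L1span g -> L1span h ->
  Lam k (fun s => g s + h s) = Lam k g + Lam k h.
Proof.
move=> [ig hg] [ih hh]; apply/eqP; rewrite -subr_eq0 -normr_le0.
apply: (@le_of_eps _ _ _ 4) => // e e0; rewrite add0r.
have [A hA] := hg _ e0; have [B hB] := hh _ e0.
have h1 := Lam_near k A ig; have h2 := Lam_near k B ih.
have h3 := Lam_near k (A ++ B) (integrable_add measurableT ig ih).
rewrite lin_cat vcomb_catE in h3.
have h4 := L1dist_add ig (integrable_vcomb A) ih (integrable_vcomb B).
move: h1 h2 h3; rewrite !ler_distl => /andP[a1 a2] /andP[b1 b2] /andP[c1 c2].
by apply/andP; split; lra.
Qed.

Lemma Lam_scale k z g : L1span g -> Lam k (fun s => z * g s) = z * Lam k g.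
Proof.
move=> [ig hg]; apply/eqP; rewrite -subr_eq0 -normr_le0.
have z0 : 0 <= `|z| by [].
apply: (@le_of_eps _ _ _ (2 * `|z|)); first by rewrite mulr_ge0.
move=> e e0; rewrite add0r.
have [A hA] := hg _ e0.
have h1 := Lam_near k A ig.
have h3 := Lam_near k (scale_comb z A) (integrable_scale measurableT z ig).
rewrite lin_scale_comb vcomb_scale_combE L1dist_scale// in h3; last exact: integrable_vcomb.
apply: le_trans (ler_distD (z * lin (l k) A) _ _) _.
rewrite -mulrBr normrM (distrC (lin _ _)).
have h4 : `|z| * L1dist g (vcomb A) <= `|z| * e by rewrite ler_wpM2l.
have h5 : `|z| * `|Lam k g - lin (l k) A| <= `|z| * e.
  by rewrite ler_wpM2l//; exact: le_trans h1 hA.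
lra.
Qed.

Lemma Lam_le_pos k g : L1span g -> Lam k g <= Int (fun s => Num.max (g s) 0).
Proof.
move=> [ig hg]; apply: (@le_of_eps _ _ _ 2) => // e e0.
have [A hA] := hg _ e0; have h1 := Lam_near k A ig.
have h2 := lin_le_pos k A.
have h3 : Int (fun s => Num.max (vcomb A s) 0) <=
    Int (fun s => Num.max (g s) 0) + L1dist g (vcomb A).
  have ip := integrable_pos ig; have iv := integrable_vcomb A.
  have idd := integrable_dist ig iv.
  rewrite /L1dist -RintegralD//; apply: le_Rintegral => //.
  - exact: integrable_pos.
  - exact: integrable_add.
  move=> s _; rewrite ge_max addr_ge0 ?le_max ?lexx ?orbT ?andbT//.
  have := ler_norm (vcomb A s - g s); rewrite distrC.
  have : g s <= Num.max (g s) 0 by rewrite le_max lexx.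
  lra.
move: h1; rewrite ler_distl => /andP[_ h1]; lra.
Qed.

Lemma Lam_ge0 k g : L1span g -> (forall s, 0 <= g s) -> 0 <= Lam k g.
Proof.
move=> hg g0; have := Lam_le_pos k (L1span_scale (-1) hg).
rewrite Lam_scale// (_ : (fun s => _) = cst 0); last first.
  by apply/funext => s; rewrite mulN1r; apply/max_idPr; rewrite oppr_le0.
by rewrite /Rintegral integral0 /= mulN1r oppr_le0.
Qed.

Lemma Lam_le k g : L1span g -> (forall s, 0 <= g s) -> Lam k g <= Int g.
Proof.
move=> hg g0; apply: le_trans (Lam_le_pos k hg) _.
rewrite (_ : (fun s => _) = g)//.
by apply/funext => s; apply/max_idPl.
Qed.

Lemma Lam_dist k g h : L1span g -> L1span h -> `|Lam k g - Lam k h| <= L1dist g h.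
Proof.
have le g1 g2 : L1span g1 -> L1span g2 -> Lam k g1 - Lam k g2 <= L1dist g1 g2.
  move=> s1 s2; have [i1 _] := s1; have [i2 _] := s2.
  have := Lam_le_pos k (L1span_sub s1 s2).
  rewrite (_ : (fun s => g1 s - g2 s) = fun s => g1 s + (-1) * g2 s); last first.
    by apply/funext => s; rewrite mulN1r.
  rewrite Lam_add//; last exact: L1span_scale.
  rewrite Lam_scale// mulN1r => h1; apply: le_trans h1 _.
  apply: le_Rintegral => //.
  - by apply: integrable_pos; exact: integrable_sub.
  - exact: integrable_dist.
  by move=> s _; rewrite ge_max normr_ge0 andbT ler_norm.
move=> sg sh; rewrite ler_norml le// andbT lerNl opprB L1distC.
exact: le.
Qed.

(** The integral against a bounded function is continuous for the L^1 distance. *)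
Lemma L1span_density (h h' : S -> R) (C : R) :
  measurable_fun setT h -> measurable_fun setT h' ->
  (forall s, `|h s - h' s| <= C) ->
  (forall H, Int (fun s => maxlin_fun H s * (h s - h' s)) = 0) ->
  forall g, L1span g -> Int (fun s => g s * (h s - h' s)) = 0.
Proof.
move=> mh mh' hC hv g [ig hg].
have mD : measurable_fun setT (fun s => h s - h' s) by exact: measurable_funB.
have iM f : intg f -> intg (fun s => f s * (h s - h' s)).
  move=> jf; have := integrable_scale measurableT C (integrable_normr jf).
  apply: integrable_dom => //.
    by apply: measurable_funM => //; exact: integrable_measurable jf.
  by move=> s _; rewrite normrM mulrC ler_wpM2r.
have vA A : Int (fun s => vcomb A s * (h s - h' s)) = 0.
  elim: A => [|p A IH].
    rewrite (_ : (fun s => _) = cst 0) ?/Rintegral ?integral0//.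
    by apply/funext => s; rewrite /vcomb lin_nil mul0r.
  rewrite (_ : (fun s => _) = fun s => p.1 * (maxlin_fun p.2 s * (h s - h' s)) +
    vcomb A s * (h s - h' s)).
    rewrite RintegralD ?RintegralZl ?hv ?mulr0 ?add0r//.
    - by apply: iM; exact: integrable_maxlin_fun.
    - by apply: integrable_scale => //; apply: iM; exact: integrable_maxlin_fun.
    - by apply: iM; exact: integrable_vcomb.
  by apply/funext => s; rewrite /vcomb lin_cons; ring.
apply/eqP; rewrite -normr_le0; apply: (@le_of_eps _ _ _ `|C|) => // e e0.
rewrite add0r; have [A hA] := hg _ e0.
have iA := integrable_vcomb A.
rewrite -(subr0 (Int _)) -(vA A) -RintegralB//; try exact: iM.
apply: le_trans (le_normr_Rintegral measurableT _) _.
  by apply: integrable_sub => //; exact: iM.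
apply: le_trans (_ : `|C| * L1dist g (vcomb A) <= _); last by rewrite ler_wpM2l.
rewrite /L1dist -RintegralZl//; last exact: integrable_dist.
apply: le_Rintegral => //.
- by apply: integrable_normr; apply: integrable_sub => //; exact: iM.
- by apply: integrable_scale => //; exact: integrable_dist.
move=> s _; rewrite -mulrBl normrM mulrC ler_wpM2r//.
by apply: le_trans (hC s) _; exact: ler_norm.
Qed.

End closure.
Unset Strict Implicit.
Unset Printing Implicit Defensive.

(** * Density of the span of max-linear functions on the ratio sigma-algebra *)

Section measurability.
Context (R : realType) (d : measure_display) (S : measurableType d).

Lemma measurable_fun_le (g : S -> R) :
  (forall b, measurable [set s | g s <= b]) -> measurable_fun setT g.
Proof.
move=> h; apply: (measurability _ (RGenOInfty.measurableE R)) => //.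
move=> _ [_ [b ->] <-]; rewrite setTI.
rewrite (_ : g @^-1` _ = ~` [set s | g s <= b]); first exact: measurableC.
by apply/seteqP; split => s /=; rewrite in_itv/= andbT ltNge => /negP.
Qed.

Lemma measurable_inv (g : S -> R) : (forall s, 0 <= g s) ->
  measurable_fun setT g -> measurable_fun setT (fun s => (g s)^-1).
Proof.
move=> g0 mg; rewrite (_ : (fun s => _) = (@powR R ^~ (-1)) \o g).
  by apply: measurableT_comp.
by apply/funext => s /=; rewrite powR_inv1.
Qed.

(** The convention for quotients in the ratio sigma-algebra, made explicit. *)
Lemma edivE (a b : R) : 0 <= a -> (a%:E / b%:E)%E =
  if b == 0 then (if a == 0 then 0%E else +oo%E) else (a / b)%:E.
Proof.
move=> a0; rewrite /inve; case: eqP => //= _.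
case: eqP => [->|/eqP an]; first by rewrite mul0e.
by rewrite gt0_muley// lte_fin lt_def an.
Qed.

Lemma measurable_ediv (g h : S -> R) : (forall s, 0 <= g s) ->
  (forall s, 0 <= h s) -> measurable_fun setT g -> measurable_fun setT h ->
  measurable_fun setT (fun s => ((g s)%:E / (h s)%:E)%E).
Proof.
move=> g0 h0 mg mh.
rewrite (_ : (fun s => _) = fun s => if h s == 0 then
   (if g s == 0 then 0%E else +oo%E) else (g s / h s)%:E); last first.
  by apply/funext => s; rewrite edivE.
apply: measurable_fun_ifT; first exact: measurable_fun_eqr.
  by apply: measurable_fun_ifT => //; exact: measurable_fun_eqr.
apply/measurable_EFinP; apply: measurable_funM => //; exact: measurable_inv.
Qed.

End measurability.

Section ratio_closure.
Context (R : realType) (T : eqType) (d : measure_display) (S : measurableType d).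
Context (mu : {measure set S -> \bar R}) (f : T -> S -> R) (alpha : R).
Context (alpha_gt0 : 0 < alpha) (f0 : forall t s, 0 <= f t s).
Context (mf : forall t, measurable_fun setT (f t)).
Let phi t s := f t s `^ alpha.
Context (iphi : forall t, mu.-integrable setT (EFin \o phi t)).
Local Notation maxlin_phi := (maxlin_fun phi).
Local Notation L1span := (L1span mu phi).

Lemma maxlin_fun1 t u s : 0 <= u -> maxlin_phi [:: (t, u)] s = u * phi t s.
Proof.
move=> u0; rewrite /maxlin_fun maxlin_cons maxlin_nil; apply/max_idPl => /=.
by rewrite mulr_ge0// powR_ge0.
Qed.

Lemma maxlin_fun_cons t u H s : maxlin_phi ((t, u) :: H) s = Num.max (u * phi t s) (maxlin_phi H s).
Proof. exact: maxlin_cons. Qed.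

Lemma measurable_maxlin_fun H : measurable_fun setT (maxlin_phi H).
Proof. by apply: integrable_measurable; exact: integrable_maxlin_fun. Qed.

Lemma measurable_maxlin_le H t : measurable [set s | maxlin_phi H s <= phi t s].
Proof.
rewrite -[X in measurable X]setTI; apply: measurable_fun_ler => //.
  exact: measurable_maxlin_fun.
exact: integrable_measurable (iphi t).
Qed.

(** The difference quotient of [v |-> max (v * phi t0, maxlin H phi)] between [1]
    and [1 + 1 / n] is a combination of max-linear functions, is bounded by
    [phi t0], and tends to [phi t0] on [{maxlin H phi <= phi t0}] and to [0]
    elsewhere. *)
Lemma L1span_orthant t0 H :
  L1span (fun s => phi t0 s * \1_[set s | maxlin_phi H s <= phi t0 s] s).
Proof.
pose A n : comb R T := [:: (n.+1%:R, (t0, 1 + n.+1%:R^-1) :: H);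
                          (- n.+1%:R, (t0, 1) :: H)].
have AE n s : vcomb phi (A n) s = n.+1%:R * (Num.max ((1 + n.+1%:R^-1) * phi t0 s)
     (maxlin_phi H s) - Num.max (phi t0 s) (maxlin_phi H s)).
  by rewrite /vcomb !lin_cons lin_nil /= !maxlin_fun_cons mul1r; ring.
apply: (L1span_dct iphi (F := fun n => vcomb phi (A n)) (iphi t0)).
- by move=> n; exact: L1span_vcomb.
- move=> n s; rewrite AE.
  have n0 : 0 < n.+1%:R :> R by [].
  have p0 : 0 <= phi t0 s by exact: powR_ge0.
  have e0 : 0 <= n.+1%:R^-1 * phi t0 s by rewrite mulr_ge0// invr_ge0.
  rewrite mulrDl mul1r ger0_norm; last first.
    by rewrite mulr_ge0// subr_ge0 ge_max !le_max lexx lerDl e0 orbT.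
  have en : phi t0 s = n.+1%:R * (n.+1%:R^-1 * phi t0 s).
    by rewrite mulrA divff ?mul1r// gt_eqF.
  rewrite [leRHS]en ler_pM2l//; move: (_^-1 * _) e0 => e e0 {en}.
  have [h1|h1] := leP (phi t0 s) (maxlin_phi H s).
    by rewrite lerBlDr ge_max; apply/andP; split; lra.
  by rewrite lerBlDr ge_max; apply/andP; split; lra.
move=> s; have p0 : 0 <= phi t0 s by exact: powR_ge0.
have [h|h] := leP (maxlin_phi H s) (phi t0 s).
  rewrite indicE mem_set// mulr1; apply: cvg_near_cst; apply: nearW => n.
  rewrite AE (max_idPl h) max_l; last first.
    by rewrite mulrDl mul1r ler_wpDr// mulr_ge0// invr_ge0.
  by rewrite mulrDl mul1r addrAC subrr add0r mulrA divff// mul1r.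
rewrite indicE memNset/= ?mulr0; last by apply/negP; rewrite -ltNge.
apply: cvg_near_cst.
have hd : 0 < maxlin_phi H s - phi t0 s by rewrite subr_gt0.
exists (Num.bound (phi t0 s / (maxlin_phi H s - phi t0 s))) => // n /= hn.
rewrite AE (max_idPr (ltW h)) max_r ?subrr ?mulr0//.
have := archi_boundP (divr_ge0 p0 (ltW hd)).
rewrite ltr_pdivrMr// => h1.
have h2 : phi t0 s <= n.+1%:R * (maxlin_phi H s - phi t0 s).
  apply: (le_trans (ltW h1)); rewrite ler_wpM2r ?(ltW hd)// ler_nat.
  exact: leqW.
rewrite mulrDl mul1r -lerBrDl mulrC ler_pdivrMr//.
by rewrite mulrC.
Qed.

Definition orthants t0 : set (set S) :=
  [set [set s | maxlin_phi H s <= phi t0 s] | H in setT].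

Lemma setI_closed_orthants t0 : setI_closed (orthants t0).
Proof.
move=> _ _ [H _ <-] [F _ <-]; exists (H ++ F) => //.
apply/seteqP; split => s /=; rewrite /maxlin_fun maxlin_cat ge_max; first by move/andP.
by move=> [-> ->].
Qed.

(** A pi-lambda argument: the sets [A] with [phi t0 * \1_A] in the closure form a
    lambda-system by linearity and dominated convergence. *)
Lemma L1span_sigma_orthants t0 A : <<s orthants t0>> A ->
  L1span (fun s => phi t0 s * \1_A s).
Proof.
pose D := [set A : set S | measurable A /\ L1span (fun s => phi t0 s * \1_A s)].
have p0 s : 0 <= phi t0 s by exact: powR_ge0.
have lD : lambda_system setT D.
  split => //.
  - split=> //; rewrite (_ : (fun s => _) = vcomb phi [:: (1, [:: (t0, 1)])]).
      exact: L1span_vcomb.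
    apply/funext => s; rewrite /vcomb lin_cons lin_nil maxlin_fun1// indicT.
    by rewrite !mul1r addr0 mulr1.
  - move=> A1 A2 A21 [mA1 h1] [mA2 h2]; split; first exact: measurableD.
    rewrite (_ : (fun s => _) = fun s => phi t0 s * \1_A1 s - phi t0 s * \1_A2 s).
      exact: L1span_sub.
    apply/funext => s; rewrite -mulrBr; congr (_ * _).
    rewrite !indicE in_setD.
    case: (boolP (s \in A2)) => h; last by rewrite andbT subr0.
    have -> : s \in A1 by move: h; rewrite !inE; exact: A21.
    by rewrite subrr.
  - move=> F ndF hF; split.
      by apply: bigcup_measurable => n _; have [] := hF n.
    apply: (L1span_dct iphi (F := fun n s => phi t0 s * \1_(F n) s) (iphi t0)).
    + by move=> n; have [] := hF n.
    + move=> n s; rewrite normrM ger0_norm// ler_piMr//.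
      by rewrite indicE; case: (_ \in _); rewrite ?normr1 ?normr0.
    move=> s; have [[n _ Fns]|nF] := pselect ((\bigcup_n F n) s).
      rewrite indicE mem_set; last by exists n.
      apply: cvg_near_cst; exists n => // k /= nk.
      by rewrite indicE mem_set//; move: (ndF _ _ nk) => /subsetPset; exact.
    rewrite indicE memNset//; apply: cvg_near_cst; apply: nearW => n.
    by rewrite indicE memNset// => Fn; apply: nF; exists n.
move=> sA; suff [] : D A by [].
move: A sA; apply: (lambda_system_subset (@setI_closed_orthants t0) lD).
  move=> _ [H _ <-]; split; first exact: measurable_maxlin_le.
  exact: L1span_orthant.
by move=> X _.
Qed.

(** Where [f t0 > 0], every ratio is a ratio of the quotients by [f t0]; these are
    real, and their sublevel sets are given by orthants. *)
Lemma ratioE t0 t1 t2 s : 0 < f t0 s -> Defs.ratio f (t1, t2) s =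
  ((f t1 s / f t0 s)%:E / (f t2 s / f t0 s)%:E)%E.
Proof.
move=> h; rewrite /Defs.ratio/= !edivE ?divr_ge0//.
have hn : f t0 s != 0 by rewrite gt_eqF.
rewrite !mulf_eq0 !invr_eq0 (negbTE hn) !orbF.
by case: ifP => // f2; congr (_%:E); field; rewrite hn f2.
Qed.

Lemma measurable_ratio (p : T * T) : measurable_fun setT (Defs.ratio f p).
Proof. by apply: measurable_ediv. Qed.

Lemma sub_sigma_ratio A : <<s family_gen (Defs.ratio f)>> A -> measurable A.
Proof.
apply: smallest_sub; first exact: sigma_algebra_measurable.
move=> _ [p _ [B mB <-]]; exact: measurable_ratio.
Qed.

Lemma powR_le_iff (a b : R) : 0 <= a -> 0 <= b -> (a `^ alpha <= b `^ alpha) = (a <= b).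
Proof.
move=> a0 b0; apply/idP/idP => [|ab]; last by rewrite ge0_ler_powR// ltW.
by apply: contraTT; rewrite -!ltNge => ba; rewrite gt0_ltr_powR.
Qed.

(** On [{f t0 > 0}] the orthants for [t0] generate the ratio sigma-algebra.  The
    set [{f t0 > 0}] is itself the complement of the orthant
    [{2 * phi t0 <= phi t0}]. *)
Lemma sigma_orthants_ratio t0 A : <<s family_gen (Defs.ratio f)>> A ->
  <<s orthants t0>> ([set s | 0 < f t0 s] `&` A).
Proof.
pose S0 := g_sigma_algebraType (orthants t0).
have mle t u : @measurable _ S0 [set s | maxlin_phi [:: (t, u)] s <= phi t0 s].
  by apply: sub_sigma_algebra; exists [:: (t, u)].
have mpos : @measurable _ S0 [set s | 0 < f t0 s].
  rewrite (_ : [set s | _] = ~` [set s | maxlin_phi [:: (t0, 2)] s <= phi t0 s]).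
    exact: measurableC.
  apply/seteqP; split => s /=; rewrite maxlin_fun1//.
    move=> h; apply/negP; rewrite -ltNge.
    have := powR_gt0 alpha h; rewrite -/(phi t0 s); lra.
  move/negP; rewrite -ltNge => h; rewrite lt_def f0 andbT.
  apply/eqP => e; move: h; rewrite /phi e powR0 ?mulr0 ?ltxx// gt_eqF//.
have mx t : measurable_fun setT ((fun s => f t s / f t0 s) : S0 -> R).
  apply: measurable_fun_le => b.
  have [b0|b0] := ltP b 0.
    rewrite (_ : [set s | _] = set0); first exact: measurable0.
    apply/seteqP; split => // s /= h; have := divr_ge0 (f0 t s) (f0 t0 s).
    by move=> h'; have := le_lt_trans (le_trans h' h) b0; rewrite ltxx.
  (* Positive thresholds decreasing to [b] reach the case [b = 0] as well. *)
  pose v (n : nat) := (b + n.+1%:R^-1) `^ (- alpha).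
  rewrite (_ : [set s | _] = ~` [set s | 0 < f t0 s] `|`
     \bigcap_n [set s | maxlin_phi [:: (t, v n)] s <= phi t0 s]).
    apply: measurableU; first exact: measurableC.
    by apply: bigcapT_measurable => n; exact: mle.
  have b1 n : 0 < b + n.+1%:R^-1 by rewrite ltr_wpDl// invr_gt0.
  have vE n s : (maxlin_phi [:: (t, v n)] s <= phi t0 s) =
      (f t s <= (b + n.+1%:R^-1) * f t0 s).
    rewrite maxlin_fun1 ?powR_ge0// /v powRN mulrC ler_pdivrMr ?powR_gt0//.
    by rewrite /phi mulrC -powRM ?(ltW (b1 n))// powR_le_iff// mulr_ge0// ltW.
  apply/seteqP; split => s /=.
    move=> h; have [h0|h0] := ltP 0 (f t0 s); last by left.
    right => n _ /=; rewrite vE -ler_pdivrMr//; apply: le_trans h _.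
    by rewrite lerDl invr_ge0.
  move=> [/negP|h].
    rewrite -leNgt => h; have -> : f t0 s = 0 by apply/le_anti; rewrite h f0.
    by rewrite invr0 mulr0.
  have [h0|h0] := ltP 0 (f t0 s); last first.
    have -> : f t0 s = 0 by apply/le_anti; rewrite h0 f0.
    by rewrite invr0 mulr0.
  apply/ler_addgt0Pr => e e0.
  have := archi_boundP (ltW (e0 : 0 < e)).
  have e1 : 0 <= e^-1 by rewrite invr_ge0 ltW.
  have hN := archi_boundP e1.
  have := h (Num.bound e^-1) I; rewrite /= vE -ler_pdivrMr// => h1 _.
  apply: le_trans h1 _; rewrite lerD2l -[leRHS]invrK lef_pV2 ?posrE ?invr_gt0//.
  by apply: le_trans (ltW hN) _; rewrite ler_nat.
pose P : set (set S) := [set A | @measurable _ S0 ([set s | 0 < f t0 s] `&` A)].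
move=> sA; suff : P A by [].
move: A sA; apply: smallest_sub.
  split => /=.
  - by rewrite /P /= setI0; exact: measurable0.
  - move=> A hA; rewrite /P /= setTD -setDE.
    rewrite (_ : _ `\` _ = [set s | 0 < f t0 s] `\` ([set s | 0 < f t0 s] `&` A)).
      exact: measurableD.
    by apply/seteqP; split => s /= [h1 h2]; split => //; [case|move=> h3; exact: h2].
  - move=> F hF; rewrite /P /= setI_bigcupr; apply: bigcup_measurable => n _.
    exact: hF.
move=> _ [[t1 t2] _ [B mB <-]]; rewrite /P /= setTI.
rewrite (_ : _ `&` _ = [set s | 0 < f t0 s] `&`
   (fun s => ((f t1 s / f t0 s)%:E / (f t2 s / f t0 s)%:E)%E) @^-1` B); last first.
  by apply/seteqP; split => s /= [h1 h2]; split => //; move: h2; rewrite (ratioE _ _ h1).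
apply: measurableI => //; rewrite -[X in measurable X]setTI.
by apply: measurable_ediv => // s; exact: divr_ge0.
Qed.

Lemma L1span_ratio t0 A : <<s family_gen (Defs.ratio f)>> A ->
  L1span (fun s => phi t0 s * \1_A s).
Proof.
move=> /sigma_orthants_ratio => /(_ t0) /L1span_sigma_orthants.
rewrite (_ : (fun s => _) = fun s => phi t0 s * \1_A s)//.
apply/funext => s; rewrite !indicE in_setI.
have [h|h] := ltP 0 (f t0 s); first by rewrite mem_set.
have -> : phi t0 s = 0.
  rewrite /phi (_ : f t0 s = 0) ?powR0 ?gt_eqF//.
  by apply/le_anti; rewrite h f0.
by rewrite !mul0r.
Qed.

End ratio_closure.

(** * Measures from real set functions; induction on nonnegative functions *)

Section measure_of_real.
Context (d : measure_display) (S : measurableType d) (R : realType).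
Context (m : set S -> R).
Context (m0 : m set0 = 0) (m_ge0 : forall A, measurable A -> 0 <= m A).
Context (m_add : forall A B, measurable A -> measurable B ->
  [disjoint A & B] -> m (A `|` B) = m A + m B).
Context (m_cont : forall G : (set S)^nat, (forall n, measurable (G n)) ->
  (forall s, (\1_(G n) s : R) @[n --> \oo] --> 0) -> m (G n) @[n --> \oo] --> 0).

(** The absolute value makes the set function nonnegative on the sets that are
    not measurable too, as the interface of measures requires. *)
Definition real_measure (A : set S) : \bar R := `|m A|%:E.

Let real_measure0 : real_measure set0 = 0%E.
Proof. by rewrite /real_measure m0 normr0. Qed.

Let real_measure_ge0 A : (0 <= real_measure A)%E.
Proof. by rewrite /real_measure lee_fin. Qed.

Lemma real_measureE A : measurable A -> real_measure A = (m A)%:E.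
Proof. by move=> mA; rewrite /real_measure ger0_norm// m_ge0. Qed.

Let real_measure_sigma_additive : semi_sigma_additive real_measure.
Proof.
move=> F mF tF mUF.
pose G n := \bigcup_(k in [set k | (n <= k)%N]) F k.
have mG n : measurable (G n) by apply: bigcup_measurable => k _; exact: mF.
have FG n : [disjoint F n & G n.+1].
  apply/disj_setPS => s [Fs [k /= nk Fk]].
  by have := tF n k I I (ex_intro _ s (conj Fs Fk)) => nk'; rewrite nk' ltnn in nk.
have GE n : G n = F n `|` G n.+1.
  apply/seteqP; split => s.
    move=> [k /= nk Fk]; have [kn|kn] := eqVneq k n; first by left; rewrite -kn.
    by right; exists k => //=; rewrite ltn_neqAle eq_sym kn.
  move=> [Fs|[k /= nk Fk]]; first by exists n => /=.
  by exists k => //=; exact: ltnW.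
(* A finitely additive function is sigma-additive as soon as the tails [G n]
   have vanishing mass. *)
have sumE n : m (\bigcup_k F k) = \sum_(0 <= i < n) m (F i) + m (G n).
  elim: n => [|n IH].
    by rewrite big_geq// add0r; congr m; apply/seteqP; split => s [k _ Fk]; exists k.
  by rewrite IH GE m_add// big_nat_recr//= addrA.
have -> : (fun n => \sum_(0 <= i < n) real_measure (F i))%E =
    fun n => (m (\bigcup_k F k) - m (G n))%:E.
  apply/funext => n.
  rewrite (eq_bigr (fun i => (m (F i))%:E)); last by move=> i _; rewrite real_measureE.
  by rewrite sumEFin (sumE n) addrK.
rewrite real_measureE//; apply: cvg_EFin; first exact: nearW.
rewrite -[X in _ --> X]subr0; apply: cvgB; first exact: cvg_cst.
apply: m_cont => // s; apply: cvg_near_cst.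
have [[k _ Fk]|nF] := pselect ((\bigcup_k F k) s); last first.
  apply: nearW => n; rewrite indicE memNset// => -[k _ Fk].
  by apply: nF; exists k.
exists k.+1 => // n /= kn; rewrite indicE memNset// => -[j /= nj Fj].
have kj := tF k j I I (ex_intro _ s (conj Fk Fj)).
by move: nj; rewrite -kj leqNgt kn.
Qed.

HB.instance Definition _ := isMeasure.Build _ _ _ real_measure
  real_measure0 real_measure_ge0 real_measure_sigma_additive.

Let real_measure_fin : fin_num_fun real_measure.
Proof. by move=> A _. Qed.

HB.instance Definition _ := Measure_isFinite.Build _ _ _ real_measure
  real_measure_fin.

Lemma finite_measure_of_real : exists M : {finite_measure set S -> \bar R},
  forall A, measurable A -> M A = (m A)%:E.
Proof. by exists real_measure => A mA; exact: real_measureE. Qed.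

End measure_of_real.

Section nonneg_ind.
Context (d : measure_display) (S : measurableType d) (R : realType).

Import HBNNSimple.

(** Every nonnegative measurable function is the increasing limit of nonnegative
    simple functions. *)
Lemma nonneg_measurable_ind (Q : (S -> R) -> Prop) :
  (forall c (A : set S), 0 <= c -> measurable A -> Q (fun s => c * \1_A s)) ->
  (forall g h : S -> R, measurable_fun setT g -> measurable_fun setT h ->
     (forall s, 0 <= g s) -> (forall s, 0 <= h s) ->
     Q g -> Q h -> Q (fun s => g s + h s)) ->
  (forall (F : nat -> S -> R) (g : S -> R), (forall n, measurable_fun setT (F n)) ->
     measurable_fun setT g -> (forall n s, 0 <= F n s) ->
     (forall n k s, (n <= k)%N -> F n s <= F k s) ->
     (forall s, F ^~ s @ \oo --> g s) -> (forall n, Q (F n)) -> Q g) ->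
  forall g : S -> R, measurable_fun setT g -> (forall s, 0 <= g s) -> Q g.
Proof.
move=> Q1 Q2 Q3 g mg g0.
have mEg : measurable_fun setT (EFin \o g) by exact/measurable_EFinP.
pose F n : {nnsfun S >-> R} := nnsfun_approx measurableT mEg n.
apply: (Q3 (fun n => F n : S -> R)) => //.
- by move=> n k s nk; have /lefP := nd_nnsfun_approx measurableT mEg nk; exact.
- move=> s; have gE0 x : [set: S] x -> (0 <= (EFin \o g) x)%E.
    by move=> _; rewrite lee_fin.
  by have /fine_cvg := cvg_nnsfun_approx measurableT mEg gE0 (I : setT s).
move=> n; pose s : seq R := finmap.enum_fset (fset_set (range (F n))).
have s0 i : 0 <= s`_i.
  have [si|si] := ltnP i (size s); last by rewrite nth_default.
  have fin : finite_set (range (F n)) by [].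
  have : s`_i \in range (F n) by rewrite -(in_fset_set fin); exact: mem_nth.
  by rewrite inE => -[x _ <-].
rewrite (_ : (F n : S -> R) = fun x =>
    \sum_(i < size s) (s`_i * \1_(F n @^-1` [set s`_i]) x)); last first.
  by apply/funext => x; rewrite fimfunEord.
move: (size s) => N; elim: N => [|k IH].
  rewrite (_ : (fun x => _) = fun x => 0 * \1_set0 x); first exact: Q1.
  by apply/funext => x; rewrite big_ord0 mul0r.
under eq_fun do rewrite big_ord_recr.
have mA i : measurable (F n @^-1` [set s`_i]) by exact: measurable_sfunP.
apply: Q2 => //.
- by apply: measurable_sum => i; apply: measurable_funM => //; exact: measurable_indic.
- by apply: measurable_funM => //; exact: measurable_indic.
- by move=> x; apply: sumr_ge0 => i _; rewrite mulr_ge0.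
- by move=> x; rewrite mulr_ge0.
exact: Q1.
Qed.

End nonneg_ind.

(** * A countable subfamily with full support and a weight *)

Section exhaustion.
Context (R : realType) (T : Type) (d : measure_display) (S : measurableType d).
Context (mu : {measure set S -> \bar R}) (f : T -> S -> R).
Context (f0 : forall t s, 0 <= f t s) (mf : forall t, measurable_fun setT (f t)).

Definition pos t : set S := [set s | 0 < f t s].
Definition posl (C : seq T) : set S := [set s | has (fun t => 0 < f t s) C].

Lemma measurable_pos t : measurable (pos t).
Proof.
rewrite /pos -[X in measurable X]setTI; apply: measurable_fun_ltr => //.
Qed.

Lemma posl_cons t C : posl (t :: C) = pos t `|` posl C.
Proof.
by apply/seteqP; split => s /=; [move=> /orP[]; [left|right] |move=> [|] h; apply/orP; [left|right]].
Qed.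

Lemma measurable_posl C : measurable (posl C).
Proof.
elim: C => [|t C IH]; last first.
  by rewrite posl_cons; apply: measurableU => //; exact: measurable_pos.
by rewrite (_ : posl [::] = set0); [exact: measurable0|apply/seteqP; split].
Qed.

(** The masses of [F `&` posl C] over the finite lists [C] have a finite supremum;
    along a sequence of lists approaching it, no further index can add any
    mass. *)
Lemma exhaust_one (F : set S) : measurable F -> (mu F < +oo)%E ->
  exists C : nat -> seq T,
    forall t, mu ((F `&` pos t) `\` \bigcup_n posl (C n)) = 0%E.
Proof.
move=> mF Ffin.
have mFU C : measurable (F `&` posl C).
  by apply: measurableI => //; exact: measurable_posl.
have vfin A : measurable A -> A `<=` F -> mu A \is a fin_num.
  move=> mA AF; rewrite ge0_fin_numE//; apply: le_lt_trans Ffin.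
  by apply: le_measure; rewrite ?inE.
have FUfin C : mu (F `&` posl C) \is a fin_num by apply: vfin => // s [].
pose v C := fine (mu (F `&` posl C)).
pose E := range v.
have hE : has_sup E.
  split; first by exists (v [::]), [::].
  exists (fine (mu F)) => _ [C _ <-]; rewrite fine_le//; first exact: vfin.
  by apply: le_measure; rewrite ?inE.
have hC n : exists C, sup E - n.+1%:R^-1 < v C.
  have n0 : 0 < n.+1%:R^-1 :> R by rewrite invr_gt0.
  by have [_ [C _ <-] h] := sup_adherent n0 hE; exists C.
have [C hCn] := choice hC; exists C => t.
set N := _ `\` _.
have mN : measurable N.
  apply: measurableD; first by apply: measurableI => //; exact: measurable_pos.
  by apply: bigcup_measurable => n _; exact: measurable_posl.
have Nfin : mu N \is a fin_num by apply: vfin => // s [[]].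
have key n : fine (mu N) <= n.+1%:R^-1.
  have h : v (C n) + fine (mu N) <= v (t :: C n).
    rewrite -fineD// fine_le ?fin_numD ?FUfin ?Nfin//.
    rewrite -measureU//.
      apply: le_measure; rewrite ?inE//; first exact: measurableU.
      move=> s [[Fs Us]|[[Fs ps] _]]; split => //; rewrite posl_cons.
        by right.
      by left.
    apply/seteqP; split => // s [[Fs Us] [_ nU]].
    by apply: nU; exists n.
  have h2 : v (t :: C n) <= sup E by apply: ub_le_sup; [case: hE|exists (t :: C n)].
  rewrite -(lerD2l (v (C n))); apply: le_trans h (le_trans h2 _).
  by rewrite -lerBlDr ltW.
apply/eqP; rewrite -(fineK Nfin) eqe eq_le fine_ge0// andbT.
apply/ler_addgt0Pr => e e0; rewrite add0r.
have e1 : 0 <= e^-1 by rewrite invr_ge0 ltW.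
apply: le_trans (key (Num.bound e^-1)) _.
rewrite -[leRHS]invrK lef_pV2 ?posrE ?invr_gt0//.
by apply: le_trans (ltW (archi_boundP e1)) _; rewrite ler_nat.
Qed.

(** Exhaust each of the countably many pieces of finite measure; what is left over
    is a set on which every [f t] vanishes a.e., so it is null by full support. *)
Lemma countable_support (t0 : T) : sigma_finite setT mu -> full_support mu f ->
  exists t : nat -> T, {ae mu, forall s, exists j, 0 < f (t j) s}.
Proof.
move=> [F TF mFfin] full.
have hex i : exists C : nat -> seq T, forall t,
    mu ((F i `&` pos t) `\` \bigcup_n posl (C n)) = 0%E.
  by have [mFi Fifin] := mFfin i; exact: exhaust_one.
have [C hC] := choice hex.
pose t j : T := if (unpickle j : option (nat * nat * nat)) is Some (i, n, k)
  then nth t0 (C i n) k else t0.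
exists t.
pose A := ~` \bigcup_j pos (t j).
have mA : measurable A.
  apply: measurableC; apply: bigcup_measurable => j _; exact: measurable_pos.
have sub i n : posl (C i n) `<=` \bigcup_j pos (t j).
  move=> s /(has_nthP t0)[k kC hk]; exists (pickle (i, n, k)) => //.
  by rewrite /pos /= /t pickleK.
have At u : {ae mu, forall s, A s -> f u s = 0}.
  suff sN : [set s | ~ (A s -> f u s = 0)] `<=`
      \bigcup_i ((F i `&` pos u) `\` \bigcup_n posl (C i n)).
    apply: negligibleS sN _; apply: negligible_bigcup => i.
    apply/negligibleP; last exact: hC.
    have [mFi _] := mFfin i.
    apply: measurableD; first by apply: measurableI => //; exact: measurable_pos.
    by apply: bigcup_measurable => n _; exact: measurable_posl.
  move=> s /= /not_implyP[As /eqP fu].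
  have [i _ Fi] : (\bigcup_i F i) s by rewrite -TF.
  exists i => //; split; first by split=> //; rewrite /pos /= lt_def fu f0.
  by move=> [n _ hn]; apply: As; exact: sub hn.
have muA : mu A = 0%E.
  apply/eqP; rewrite eq_le measure_ge0 andbT leNgt; apply/negP => h.
  by apply: full; exists A; split.
exists A; split => // s /= h; rewrite /A /= => -[j _ pj]; apply: h.
by exists j.
Qed.

End exhaustion.

Section weight.
Context (R : realType) (T : eqType) (d : measure_display) (S : measurableType d).
Context (mu : {measure set S -> \bar R}) (f : T -> S -> R) (alpha : R).
Context (alpha_gt0 : 0 < alpha) (f0 : forall t s, 0 <= f t s).
Context (mf : forall t, measurable_fun setT (f t)).
Let phi t s := f t s `^ alpha.
Context (iphi : forall t, mu.-integrable setT (EFin \o phi t)).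
Local Notation L1span := (L1span mu phi).
Local Notation Int g := (Rintegral mu setT g).
Local Notation intg g := (mu.-integrable setT (EFin \o g)).
Local Notation S' := (g_sigma_algebraType (family_gen (Defs.ratio f))).
Context (t : nat -> T).

Let phi0 u s : 0 <= phi u s. Proof. exact: powR_ge0. Qed.
#[local] Hint Resolve phi0 : core.

Definition first_pos s : nat :=
  if pselect (exists j, 0 < f (t j) s) is left h then ex_minn h else 0%N.
Definition wgt j : R := 2^-1 ^+ j.+1 / (1 + Int (phi (t j))).
(** The value at [s] uses the first index [j] with [f (t j) s > 0], so that
    the quotients [phi u / Phi] are, layer by layer, powers of a single ratio.  The
    weights make the sum over the layers integrable. *)
Definition Phi s : R := wgt (first_pos s) * phi (t (first_pos s)) s.
Definition upto n : set S := posl f [seq t j | j <- iota 0 n].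
Definition layer n : set S := pos f (t n) `\` upto n.

Lemma Int_phi_ge0 j : 0 <= Int (phi (t j)).
Proof. by apply: Rintegral_ge0 => s _; exact: phi0. Qed.

Lemma wgt_gt0 j : 0 < wgt j.
Proof.
rewrite /wgt divr_gt0 ?exprn_gt0 ?invr_gt0//.
by have := Int_phi_ge0 j; lra.
Qed.

Lemma Phi_ge0 s : 0 <= Phi s.
Proof. by rewrite mulr_ge0// ltW// wgt_gt0. Qed.

Lemma uptoP n s : upto n s <-> exists2 j, (j < n)%N & 0 < f (t j) s.
Proof.
rewrite /upto /posl /= has_map; split.
  by move=> /hasP[j]; rewrite mem_iota add0n => /= jn h; exists j.
by move=> [j jn h]; apply/hasP; exists j => //; rewrite mem_iota.
Qed.

Lemma upto0 : upto 0 = set0. Proof. by apply/seteqP; split. Qed.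

Lemma upto_mono m n : (m <= n)%N -> upto m `<=` upto n.
Proof.
move=> mn s /uptoP[j jm h]; apply/uptoP; exists j => //.
exact: leq_trans jm mn.
Qed.

Lemma uptoS n s :
  \1_(upto n.+1) s = \1_(upto n) s + \1_(layer n) s :> R.
Proof.
rewrite !indicE; have [h|h] := pselect (upto n s).
  rewrite (mem_set h) (mem_set (upto_mono (leqnSn n) h)).
  by rewrite memNset ?addr0// => -[].
rewrite (memNset h) add0r; congr (nat_of_bool _)%:R.
apply/idP/idP; rewrite !inE.
  move=> /uptoP[j]; rewrite ltnS leq_eqVlt => /orP[/eqP->|jn] hj; last first.
    by exfalso; apply: h; apply/uptoP; exists j.
  by split.
by move=> [hn _]; apply/uptoP; exists n.
Qed.

Lemma first_pos_layer n s : layer n s -> first_pos s = n.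
Proof.
move=> [hn hU]; rewrite /first_pos; case: pselect => [h|nh]; last first.
  by exfalso; apply: nh; exists n.
case: ex_minnP => m hm minm; apply/eqP; rewrite eqn_leq minm//= leqNgt.
by apply/negP => mn; apply: hU; apply/uptoP; exists m.
Qed.

Lemma Phi_layer n s : Phi s * \1_(layer n) s = wgt n * (phi (t n) s * \1_(layer n) s).
Proof.
rewrite mulrA indicE; have [h|h] := pselect (layer n s).
  by rewrite mem_set// !mulr1 /Phi (first_pos_layer h).
by rewrite memNset// !mulr0.
Qed.

Lemma Phi_gt0 s : (exists j, 0 < f (t j) s) -> 0 < Phi s.
Proof.
move=> h; rewrite /Phi /first_pos; case: pselect => // h'.
by case: ex_minnP => m hm _; rewrite mulr_gt0 ?wgt_gt0// powR_gt0.
Qed.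

Lemma Phi_eq0 s : (forall j, ~ 0 < f (t j) s) -> Phi s = 0.
Proof.
move=> h; rewrite /Phi; set k := first_pos s.
suff -> : phi (t k) s = 0 by rewrite mulr0.
rewrite /phi (_ : f (t k) s = 0) ?powR0 ?gt_eqF//.
by apply/eqP; rewrite eq_le f0 andbT leNgt; apply/negP; exact: h.
Qed.

Lemma measurable_ratio_gen p : measurable_fun setT (Defs.ratio f p : S' -> \bar R).
Proof.
move=> _ B mB; apply: sub_sigma_algebra; exists p => //.
by exists B => //; rewrite setTI.
Qed.

Lemma measurable_pos_gen u : @measurable _ S' (pos f u).
Proof.
rewrite (_ : pos f u = Defs.ratio f (u, u) @^-1` [set 1%E]).
  have m1 : measurable [set 1%E : \bar R] by exact: emeasurable_set1.
  by have := @measurable_ratio_gen (u, u) measurableT _ m1; rewrite setTI.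
apply/seteqP; split => s /=; rewrite /pos /Defs.ratio /= edivE//.
  by move=> h; rewrite gt_eqF// divff// gt_eqF.
case: eqP => [e|/eqP fn _]; first by move/eqP; rewrite eqe eq_sym oner_eq0.
by rewrite lt_def fn f0.
Qed.

Lemma measurable_posl_gen (C : seq T) : @measurable _ S' (posl f C).
Proof.
elim: C => [|u C IH]; last first.
  by rewrite posl_cons; apply: measurableU => //; exact: measurable_pos_gen.
by rewrite (_ : posl f [::] = set0); [exact: measurable0|apply/seteqP; split].
Qed.

Lemma measurable_upto_gen n : @measurable _ S' (upto n).
Proof. exact: measurable_posl_gen. Qed.

Lemma measurable_layer_gen n : @measurable _ S' (layer n).
Proof.
by apply: measurableD; [exact: measurable_pos_gen|exact: measurable_upto_gen].
Qed.

Lemma measurable_gen (A : set S) : @measurable _ S' A -> measurable A.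
Proof. exact: (sub_sigma_ratio f0 mf). Qed.

Lemma measurable_fun_gen (h : S -> R) :
  measurable_fun setT (h : S' -> R) -> measurable_fun setT h.
Proof.
move=> mh _ B mB; apply: measurable_gen; exact: mh.
Qed.

(** The sets [upto n] increase to the set where [Phi] does not vanish. *)
Lemma upto_cvg (g : S -> R) s : ((forall j, ~ 0 < f (t j) s) -> g s = 0) ->
  (g s * \1_(upto n) s) @[n --> \oo] --> g s.
Proof.
move=> h; apply: cvg_near_cst.
have [[j hj]|nj] := pselect (exists j, 0 < f (t j) s); last first.
  by apply: nearW => n; rewrite h ?mul0r// => j hj; apply: nj; exists j.
exists j.+1 => // n /= jn; rewrite indicE mem_set ?mulr1//.
by apply/uptoP; exists j.
Qed.

Lemma L1span_Phi_upto n (A : set S) : @measurable _ S' A ->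
  L1span (fun s => Phi s * \1_(upto n) s * \1_A s).
Proof.
move=> mA; elim: n => [|n IH].
  rewrite (_ : (fun s => _) = vcomb phi [::]); first exact: L1span_vcomb.
  by apply/funext => s; rewrite /vcomb lin_nil upto0 indic0 mulr0 mul0r.
rewrite (_ : (fun s => _) = fun s => Phi s * \1_(upto n) s * \1_A s +
    wgt n * (phi (t n) s * \1_(layer n `&` A) s)).
  apply: L1span_add => //; apply: L1span_scale => //; apply: L1span_ratio => //.
  by apply: (@measurableI _ S') => //; exact: measurable_layer_gen.
apply/funext => s; rewrite uptoS mulrDr mulrDl; congr (_ + _).
by rewrite Phi_layer indicI /=; ring.
Qed.

Lemma Int_Phi_upto n : Int (fun s => Phi s * \1_(upto n) s) <= 1 - 2^-1 ^+ n.
Proof.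
have iU m : intg (fun s => Phi s * \1_(upto m) s).
  have [] := L1span_Phi_upto m (@measurableT _ S').
  by under eq_fun do rewrite indicT mulr1.
elim: n => [|n IH].
  by rewrite expr0 subrr /Rintegral; under eq_integral do
    rewrite upto0 indic0 mulr0; rewrite integral0.
have il : intg (fun s => phi (t n) s * \1_(layer n) s).
  by have [] := L1span_ratio alpha_gt0 f0 iphi (t n) (measurable_layer_gen n).
rewrite (_ : (fun s => _) = fun s => Phi s * \1_(upto n) s +
    wgt n * (phi (t n) s * \1_(layer n) s)); last first.
  by apply/funext => s; rewrite uptoS mulrDr Phi_layer.
rewrite RintegralD//; last exact: integrable_scale.
rewrite RintegralZl//.
have h1 : Int (fun s => phi (t n) s * \1_(layer n) s) <= Int (phi (t n)).
  apply: le_Rintegral => //; first exact: iphi.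
  by move=> s _; rewrite ler_piMr ?phi0// indicE; case: (_ \in _).
have h2 : wgt n * Int (fun s => phi (t n) s * \1_(layer n) s) <= 2^-1 ^+ n.+1.
  apply: le_trans (_ : wgt n * (1 + Int (phi (t n))) <= _).
    by rewrite ler_wpM2l ?(ltW (wgt_gt0 _))//; lra.
  by rewrite /wgt mulfVK// gt_eqF//; have := Int_phi_ge0 n; lra.
have h3 : 2^-1 ^+ n = 2^-1 ^+ n.+1 + 2^-1 ^+ n.+1 :> R by rewrite exprS; field.
lra.
Qed.

(** Monotone convergence, with the uniform bound [Int_Phi_upto]. *)
Lemma integrable_Phi : intg Phi.
Proof.
have iU m : intg (fun s => Phi s * \1_(upto m) s).
  have [] := L1span_Phi_upto m (@measurableT _ S').
  by under eq_fun do rewrite indicT mulr1.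
have cvU s : (Phi s * \1_(upto n) s) @[n --> \oo] --> Phi s.
  by apply: upto_cvg; exact: Phi_eq0.
have mPhi : measurable_fun setT Phi.
  apply: (measurable_fun_cvg (h := fun n s => Phi s * \1_(upto n) s)) => // n.
  exact: integrable_measurable (iU n).
apply/integrableP; split; first exact/measurable_EFinP.
have U0 n s : 0 <= Phi s * \1_(upto n) s by rewrite mulr_ge0// Phi_ge0.
under eq_integral => s _ do rewrite /= ger0_norm ?Phi_ge0//.
have cv := @cvg_monotone_convergence _ _ _ mu setT measurableT
  (fun n s => (Phi s * \1_(upto n) s)%:E).
have lim_eq s : (limn (fun n => (Phi s * \1_(upto n) s)%:E)) = (Phi s)%:E.
  by apply/cvg_lim => //; apply: cvg_EFin; [exact: nearW|exact: cvU].
rewrite (eq_integral (fun s => limn (fun n => (Phi s * \1_(upto n) s)%:E)));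
  last by move=> s _; rewrite lim_eq.
have ndU s a b : (a <= b)%N ->
    ((Phi s * \1_(upto a) s)%:E <= (Phi s * \1_(upto b) s)%:E)%E.
  move=> ab; rewrite lee_fin ler_wpM2l ?Phi_ge0// !indicE ler_nat.
  have [h|h] := pselect (upto a s); last by rewrite memNset.
  by rewrite mem_set// mem_set//; exact: upto_mono h.
have mU n : measurable_fun setT (fun s => (Phi s * \1_(upto n) s)%:E).
  by apply/measurable_EFinP; exact: integrable_measurable (iU n).
have UE0 n s : (0 <= (Phi s * \1_(upto n) s)%:E)%E by rewrite lee_fin.
have /cvg_lim <- // := cv mU (fun n s _ => UE0 n s) (fun s _ a b => @ndU s a b).
apply: le_lt_trans (ltry 1); apply: lime_le.
  apply: ereal_nondecreasing_is_cvgn => a b ab; apply: ge0_le_integral => //.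
  by move=> s _; exact: ndU.
apply: nearW => n; have := Int_Phi_upto n; rewrite /Rintegral => h.
rewrite -[X in (X <= _)%E](fineK (integrable_fin_num measurableT (iU n))).
rewrite lee_fin; apply: le_trans h _; rewrite gerBl.
by rewrite exprn_ge0.
Qed.

Lemma L1span_Phi (A : set S) : @measurable _ S' A ->
  L1span (fun s => Phi s * \1_A s).
Proof.
move=> mA.
apply: (L1span_dct iphi (F := fun n s => Phi s * \1_(upto n) s * \1_A s)
   integrable_Phi).
- by move=> n; exact: L1span_Phi_upto.
- move=> n s; have P0 := Phi_ge0 s.
  have e : \1_(upto n) s * \1_A s = \1_(upto n `&` A) s :> R by rewrite indicI.
  rewrite -mulrA e ger0_norm; last exact: mulr_ge0.
  by rewrite ler_piMr// indicE; case: (s \in _).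
move=> s; under eq_fun do rewrite mulrAC.
by apply: (@upto_cvg (fun s => Phi s * \1_A s)) => h; rewrite Phi_eq0// mul0r.
Qed.

(** On [layer n] the quotient is a constant times a power of the ratio of [f u] and
    [f (t n)]. *)
Lemma measurable_quot u : measurable_fun setT ((fun s => phi u s / Phi s) : S' -> R).
Proof.
have y0 s : (forall j, ~ 0 < f (t j) s) -> phi u s / Phi s = 0.
  by move=> h; rewrite Phi_eq0// invr0 mulr0.
apply: (@measurable_fun_cvg _ S' R setT (fun n s => phi u s / Phi s * \1_(upto n) s)); last first.
  by move=> s _; apply: (@upto_cvg (fun s => phi u s / Phi s)) => h; exact: y0.
elim=> [|n IH].
  by under eq_fun do rewrite upto0 indic0 mulr0; exact: measurable_cst.
under eq_fun do rewrite uptoS mulrDr; apply: measurable_funD => //.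
rewrite (_ : (fun s => _) = fun s =>
   (wgt n)^-1 * (fine (Defs.ratio f (u, t n) s)) `^ alpha * \1_(layer n) s); last first.
  apply/funext => s; rewrite !indicE; have [h|h] := pselect (layer n s); last first.
    by rewrite memNset// !mulr0.
  rewrite mem_set// !mulr1 /Phi (first_pos_layer h).
  have [hp _] := h; rewrite /Defs.ratio /= edivE// gt_eqF//=.
  rewrite powRM ?invr_ge0// -(powR_inv1 (ltW hp)) -powRrM mulN1r powRN.
  by rewrite invfM mulrCA.
apply: measurable_funM; last by apply: measurable_indic; exact: measurable_layer_gen.
apply: measurable_funM; first exact: measurable_cst.
have mr : measurable_fun setT ((fun s => fine (Defs.ratio f (u, t n) s)) : S' -> R).
  have fm := @fine_measurable R setT measurableT.
  exact: (measurableT_comp fm (@measurable_ratio_gen (u, t n))).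
exact: (measurableT_comp (measurable_powR alpha) mr).
Qed.

End weight.

(** * Densities of the functionals on the ratio sigma-algebra *)

Section real_integral_ae.
Context (R : realType) (d : measure_display) (S : measurableType d).
Context (mu : {measure set S -> \bar R}).

Lemma Rintegral_ae_eq (g h : S -> R) : measurable_fun setT g ->
  measurable_fun setT h -> {ae mu, forall s, g s = h s} ->
  Rintegral mu setT g = Rintegral mu setT h.
Proof.
move=> mg mh gh; rewrite /Rintegral; congr fine.
apply: ae_eq_integral => //; try exact/measurable_EFinP.
by apply: filterS gh => s -> _.
Qed.

Lemma Rintegral_le0_ae (g : S -> R) : mu.-integrable setT (EFin \o g) ->
  (forall s, 0 <= g s) -> Rintegral mu setT g <= 0 -> {ae mu, forall s, g s = 0}.
Proof.
move=> ig g0 h; have e : (\int[mu]_s `|(g s)%:E| = 0)%E.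
  under eq_integral do rewrite /= ger0_norm//.
  rewrite -(fineK (integrable_fin_num measurableT ig)); congr (_%:E).
  by apply/le_anti; rewrite h fine_ge0//; apply: integral_ge0 => s _; rewrite lee_fin.
have /(ae_eq_integral_abs _ measurableT) := e.
by move=> /(_ (measurable_int _ ig)); apply: filterS => s /(_ I) /= [].
Qed.

End real_integral_ae.

Section density.
Context (R : realType) (T : eqType) (d : measure_display) (S : measurableType d).
Context (mu : {measure set S -> \bar R}) (f : T -> S -> R) (alpha : R).
Context (alpha_gt0 : 0 < alpha) (f0 : forall t s, 0 <= f t s).
Context (mf : forall t, measurable_fun setT (f t)).
Let phi t s := f t s `^ alpha.
Context (iphi : forall t, mu.-integrable setT (EFin \o phi t)).
Local Notation maxlin_phi := (maxlin_fun phi).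
Local Notation L1span := (L1span mu phi).
Local Notation Int g := (Rintegral mu setT g).
Local Notation intg g := (mu.-integrable setT (EFin \o g)).
Local Notation S' := (g_sigma_algebraType (family_gen (Defs.ratio f))).
Context (t : nat -> T) (tpos : {ae mu, forall s, exists j, 0 < f (t j) s}).
Local Notation Phi := (Phi mu f alpha t).

Context (n : nat) (l : 'I_n.+1 -> form R T -> R).
Context (hl : forall k, homogeneous (l k)) (al : forall k, alternating (l k)).
Context (suml : forall H, \sum_k l k H = Int (maxlin_phi H)).
Local Notation Lam := (Lam mu phi l).

Let phi0 u s : 0 <= phi u s. Proof. exact: powR_ge0. Qed.
Let P0 s : 0 <= Phi s. Proof. exact: Phi_ge0. Qed.
Let iP : intg Phi. Proof. exact: integrable_Phi. Qed.
Let spanP A : @measurable _ S' A -> L1span (fun s => Phi s * \1_A s).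
Proof. exact: L1span_Phi. Qed.

Lemma indic01 (A : set S) s : 0 <= (\1_A s : R) <= 1.
Proof. by rewrite indicE; case: (s \in A); rewrite /= ?lexx ?ler01. Qed.

Let PA0 (A : set S) s : 0 <= Phi s * \1_A s.
Proof. by rewrite mulr_ge0//; case/andP: (indic01 A s). Qed.

Let ref_mass A := Int (fun s => Phi s * \1_A s).
Let Lam_mass k A := Lam k (fun s => Phi s * \1_A s).

Let Lam_mass_le k A : @measurable _ S' A -> 0 <= Lam_mass k A <= ref_mass A.
Proof.
move=> mA; apply/andP; split.
  by apply: Lam_ge0 => //; exact: spanP.
by apply: Lam_le => //; exact: spanP.
Qed.

(** Dominated convergence with bound [Phi]; continuity of the smaller set function
    [Lam_mass] follows by comparison. *)
Let ref_mass_cont (G : (set S)^nat) : (forall n, @measurable _ S' (G n)) ->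
  (forall s, (\1_(G n) s : R) @[n --> \oo] --> 0) -> ref_mass (G n) @[n --> \oo] --> 0.
Proof.
move=> mG G0.
have iG m : intg (fun s => Phi s * \1_(G m) s) by have [] := spanP (mG m).
have mF m : measurable_fun setT (fun s => Phi s * \1_(G m) s).
  exact: integrable_measurable (iG m).
have FP m s : `|Phi s * \1_(G m) s| <= Phi s.
  by rewrite ger0_norm// ler_piMr//; case/andP: (indic01 (G m) s).
have Fc s : (Phi s * \1_(G m) s) @[m --> \oo] --> (0 : R).
  by rewrite -[X in _ --> X](mulr0 (Phi s)); apply: cvgM; [exact: cvg_cst|exact: G0].
have [_ cv] := L1_dct (g := cst 0) iP mF FP Fc.
apply: cvg_trans cv; apply: near_eq_cvg; apply: nearW => m.
rewrite /L1dist /ref_mass; congr Rintegral; apply/funext => s /=.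
by rewrite subr0 ger0_norm.
Qed.

Let indicU (A B : set S) s : [disjoint A & B] ->
  Phi s * \1_(A `|` B) s = Phi s * \1_A s + Phi s * \1_B s.
Proof.
move=> /disj_setPS AB; rewrite -mulrDr; congr (_ * _).
rewrite !indicE in_setU; case: (boolP (s \in A)) => hA; case: (boolP (s \in B)) => hB;
  rewrite /= ?addr0 ?add0r//.
by move: hA hB; rewrite !inE => hA hB; have := AB s (conj hA hB).
Qed.

Lemma kappa_exists : exists kappa : {finite_measure set S' -> \bar R},
  forall A, measurable A -> kappa A = (ref_mass A)%:E.
Proof.
apply: finite_measure_of_real.
- rewrite /ref_mass (_ : (fun s => _) = cst 0) ?/Rintegral ?integral0//.
  by apply/funext => s; rewrite indic0 mulr0.
- by move=> A mA; apply: Rintegral_ge0 => s _; exact: PA0.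
- move=> A B mA mB AB; rewrite /ref_mass -RintegralD//.
  + by congr Rintegral; apply/funext => s; exact: indicU.
  + by have [] := spanP mA.
  + by have [] := spanP mB.
exact: ref_mass_cont.
Qed.

Lemma nu_exists k : exists nu : {finite_measure set S' -> \bar R},
  forall A, measurable A -> nu A = (Lam_mass k A)%:E.
Proof.
apply: finite_measure_of_real.
- have := Lam_mass_le k (@measurable0 _ S').
  rewrite /ref_mass (_ : (fun s => _) = cst 0); last first.
    by apply/funext => s; rewrite indic0 mulr0.
  by rewrite /Rintegral integral0 /= => h; apply/le_anti; rewrite andbC.
- by move=> A mA; case/andP: (Lam_mass_le k mA).
- move=> A B mA mB AB; rewrite /Lam_mass -Lam_add//; [|exact: spanP|exact: spanP].
  by congr (Lam k); apply/funext => s; exact: indicU.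
move=> G mG G0; apply: (@squeeze_cvgr _ _ _ _ (cst 0) (fun n => ref_mass (G n))).
- by apply: nearW => m; exact: Lam_mass_le.
- exact: cvg_cst.
exact: ref_mass_cont.
Qed.

(** [kappa] lives on the ratio sigma-algebra and [mu] on the original one; this is
    the change of measure between them. *)
Lemma integral_kappa (kappa : {measure set S' -> \bar R}) :
  (forall A, measurable A -> kappa A = (ref_mass A)%:E) ->
  forall y : S' -> R, measurable_fun setT y -> (forall s, 0 <= y s) ->
  (\int[kappa]_s (y s)%:E = \int[mu]_s (Phi s * y s)%:E)%E.
Proof.
move=> hk; have mg (h : S' -> R) : measurable_fun setT h ->
    measurable_fun setT (h : S -> R) by exact: measurable_fun_gen.
have mP : measurable_fun setT Phi by exact: integrable_measurable iP.
apply: (@nonneg_measurable_ind _ S' R (fun y =>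
  (\int[kappa]_s (y s)%:E = \int[mu]_s (Phi s * y s)%:E)%E)).
- move=> c A c0 mA.
  have mA' : measurable (A : set S) by exact: measurable_gen mA.
  have mi : measurable_fun setT ((fun s => (\1_A s)%:E) : S' -> \bar R).
    by apply/measurable_EFinP; exact: measurable_indic.
  have mi' : measurable_fun setT (fun s : S => (Phi s * \1_A s)%:E).
    by apply/measurable_EFinP; apply: measurable_funM => //; exact: measurable_indic.
  have i0 s : setT s -> (0 <= (\1_A s : R)%:E)%E.
    by move=> _; rewrite lee_fin; case/andP: (indic01 A s).
  have i0' s : setT s -> (0 <= (Phi s * \1_A s)%:E)%E by move=> _; rewrite lee_fin.
  have c0' : (0 <= c%:E)%E by rewrite lee_fin.
  rewrite -[LHS]/(\int[kappa]_s (c%:E * (\1_A s)%:E))%E.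
  rewrite (ge0_integralZl kappa measurableT mi i0 c0').
  rewrite integral_indic// setIT hk// /ref_mass.
  under [in RHS]eq_integral do rewrite mulrCA EFinM.
  rewrite (ge0_integralZl mu measurableT mi' i0' c0').
  congr (_ * _)%E; rewrite fineK//.
  by apply: (integrable_fin_num measurableT); have [] := spanP mA.
- move=> g h mg' mh g0 h0 eg eh.
  have Eg0 s : setT s -> (0 <= (g s)%:E)%E by move=> _; rewrite lee_fin.
  have Eh0 s : setT s -> (0 <= (h s)%:E)%E by move=> _; rewrite lee_fin.
  have mEg : measurable_fun setT (EFin \o g) by exact/measurable_EFinP.
  have mEh : measurable_fun setT (EFin \o h) by exact/measurable_EFinP.
  rewrite -[LHS]/(\int[kappa]_s ((g s)%:E + (h s)%:E))%E.
  rewrite (ge0_integralD kappa measurableT Eg0 mEg Eh0 mEh) eg eh.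
  under [in RHS]eq_integral do rewrite mulrDr EFinD.
  rewrite ge0_integralD//.
  + by move=> s _; rewrite lee_fin mulr_ge0.
  + by apply/measurable_EFinP; apply: measurable_funM => //; exact: mg.
  + by move=> s _; rewrite lee_fin mulr_ge0.
  + by apply/measurable_EFinP; apply: measurable_funM => //; exact: mg.
move=> F g mF mg' F0 ndF Fg eF.
have cv1 : (\int[kappa]_s (F m s)%:E)%E @[m --> \oo] --> (\int[kappa]_s (g s)%:E)%E.
  have := @cvg_monotone_convergence _ S' _ kappa setT measurableT
    (fun m s => (F m s)%:E).
  rewrite (eq_integral (EFin \o g)); last first.
    by move=> s _ /=; apply/cvg_lim => //; apply: cvg_EFin; [exact: nearW|exact: Fg].
  apply.
  + by move=> m; apply/measurable_EFinP.
  + by move=> m s _; rewrite lee_fin.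
  + by move=> s _ a b ab; rewrite lee_fin ndF.
have cv2 : (\int[mu]_s (Phi s * F m s)%:E)%E @[m --> \oo] -->
    (\int[mu]_s (Phi s * g s)%:E)%E.
  have := @cvg_monotone_convergence _ S _ mu setT measurableT
    (fun m s => (Phi s * F m s)%:E).
  rewrite (eq_integral (fun s => (Phi s * g s)%:E)); last first.
    move=> s _ /=; apply/cvg_lim => //; apply: cvg_EFin; first exact: nearW.
    by apply: cvgM; [exact: cvg_cst|exact: Fg].
  apply.
  + by move=> m; apply/measurable_EFinP; apply: measurable_funM => //; exact: mg.
  + by move=> m s _; rewrite lee_fin mulr_ge0.
  + by move=> s _ a b ab; rewrite lee_fin ler_wpM2l// ndF.
have ee : (fun m => \int[kappa]_s (F m s)%:E)%E = (fun m => \int[mu]_s (Phi s * F m s)%:E)%E.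
  by apply/funext => m; exact: eF.
rewrite ee in cv1.
exact: (cvg_unique _ cv1 cv2).
Qed.

Lemma radon_nikodym_Lam k : exists h : S' -> R, [/\ measurable_fun setT h,
  forall s, 0 <= h s & forall A, @measurable _ S' A ->
    (Lam_mass k A)%:E = (\int[mu]_s (Phi s * (h s * \1_A s))%:E)%E].
Proof.
have [kappa hk] := kappa_exists; have [nu hn] := nu_exists k.
have dom : nu `<< kappa.
  apply/null_content_dominatesP => A mA k0.
  have [e] : (ref_mass A)%:E = 0%E by rewrite -(hk A mA); exact: k0.
  apply: etrans (hn A mA) _; congr (_%:E); apply/le_anti.
  by have := Lam_mass_le k mA; rewrite e andbC.
have [h [h0 hfin ih hA]] := radon_nikodym_sigma_finite dom.
have mh : measurable_fun setT (fun s => fine (h s)).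
  exact: (measurableT_comp (@fine_measurable R setT measurableT) (measurable_int _ ih)).
exists (fun s => fine (h s)); split => //.
  by move=> s; rewrite fine_ge0.
move=> A mA; apply: etrans (esym (hn A mA)) _; apply: etrans (hA A mA) _.
rewrite [LHS]integral_mkcond.
have my : measurable_fun setT ((fun s => fine (h s) * \1_A s) : S' -> R).
  by apply: measurable_funM => //; exact: measurable_indic.
have y0 s : 0 <= fine (h s) * \1_A s.
  by rewrite mulr_ge0 ?fine_ge0//; case/andP: (indic01 A s).
apply: etrans (integral_kappa hk my y0); apply: eq_integral => s _.
rewrite patchE indicE.
by case: (s \in A); rewrite ?mulr1 ?mulr0// fineK.
Qed.

(** The mass of the functional on [B = {h > 1}] is at most the reference mass,
    so [Phi * (h - 1)] vanishes a.e. on [B] and [B] is null, as [Phi > 0] a.e.;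
    truncating [h] at [1] therefore changes nothing. *)
Lemma radon_nikodym_Lam_le1 k : exists h : S' -> R, [/\ measurable_fun setT h,
  forall s, 0 <= h s <= 1 & forall A, @measurable _ S' A ->
    Lam_mass k A = Int (fun s => Phi s * \1_A s * h s)].
Proof.
have [h [mh h0 hA]] := radon_nikodym_Lam k.
have mP : measurable_fun setT Phi by exact: integrable_measurable iP.
have mhS : measurable_fun setT (h : S -> R) by exact: measurable_fun_gen mh.
have E A : @measurable _ S' A -> Lam_mass k A = Int (fun s => Phi s * (h s * \1_A s)).
  by move=> mA; rewrite /Rintegral -hA.
have hA0 A s : 0 <= Phi s * (h s * \1_A s).
  apply: mulr_ge0; first exact: P0.
  by apply: mulr_ge0; [exact: h0|case/andP: (indic01 A s)].
have mhA A : @measurable _ S' A -> measurable_fun setT (fun s : S => Phi s * (h s * \1_A s)).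
  move=> mA; do 2 apply: measurable_funM => //.
  by apply: measurable_indic; exact: measurable_gen mA.
have iA A : @measurable _ S' A -> intg (fun s => Phi s * (h s * \1_A s)).
  move=> mA; apply/integrableP; split; first by apply/measurable_EFinP; exact: mhA.
  under eq_integral do rewrite /= ger0_norm//.
  by rewrite -hA// ltry.
pose B : set S' := [set s | 1 < h s].
have mB : measurable B.
  rewrite /B -[X in measurable X]setTI; apply: measurable_fun_ltr => //.
have aeB : {ae mu, forall s, Phi s * (h s * \1_B s) - Phi s * \1_B s = 0}.
  have iB := iA _ mB; have iB' : intg (fun s => Phi s * \1_B s) by have [] := spanP mB.
  apply: Rintegral_le0_ae.
  - exact: integrable_sub.
  - move=> s; rewrite subr_ge0 ler_wpM2l// indicE.
    have [hB|hB] := pselect (B s); last by rewrite memNset// mulr0.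
    by rewrite mem_set// mulr1 ltW.
  - by rewrite RintegralB// -E// subr_le0; case/andP: (Lam_mass_le k mB).
have aeh : {ae mu, forall s : S, h s <= 1}.
  apply: filterS2 tpos aeB => s /(Phi_gt0 mu alpha) Ps /eqP.
  rewrite -mulrBr mulf_eq0 gt_eqF//= leNgt => hB; apply/negP => h1.
  by move: hB; rewrite indicE mem_set// mulr1 subr_eq0 => /eqP e; rewrite e ltxx in h1.
exists (fun s => Num.min (h s) 1); split.
- by apply: measurable_minr.
- by move=> s; rewrite le_min h0 ler01 ge_min lexx orbT.
move=> A mA; rewrite E//; apply: Rintegral_ae_eq.
- exact: mhA.
- apply: measurable_funM; last by apply: measurable_minr.
  apply: measurable_funM => //; apply: measurable_indic; exact: measurable_gen mA.
by apply: filterS aeh => s /= h1; rewrite (min_idPl h1); ring.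
Qed.

(** The identity for [Phi * \1_A] extends to [Phi * y], with [y] nonnegative and
    measurable for the ratio sigma-algebra, by linearity and continuity of [Lam].
    It applies to max-linear functions because they are [Phi] times a max-linear
    form of the quotients [phi u / Phi]. *)
Lemma density_exists k : exists h : S' -> R, [/\ measurable_fun setT h,
  forall s, 0 <= h s <= 1 & forall H, l k H = Int (fun s => maxlin_phi H s * h s)].
Proof.
have [h [mh h01 hA]] := radon_nikodym_Lam_le1 k.
have mhS : measurable_fun setT (h : S -> R) by exact: measurable_fun_gen mh.
have mP : measurable_fun setT Phi by exact: integrable_measurable iP.
have iM g : intg g -> intg (fun s => g s * h s).
  move=> ig; apply: integrable_dom (integrable_normr ig) => //.
    by apply: measurable_funM => //; exact: integrable_measurable ig.
  by move=> s _; rewrite normrM ler_piMr// ger0_norm; case/andP: (h01 s).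
have key : forall y : S' -> R, measurable_fun setT y -> (forall s, 0 <= y s) ->
    intg (fun s => Phi s * y s) -> L1span (fun s => Phi s * y s) /\
    Lam k (fun s => Phi s * y s) = Int (fun s => Phi s * y s * h s).
  apply: (@nonneg_measurable_ind _ S' R (fun y =>
    intg (fun s => Phi s * y s) -> L1span (fun s => Phi s * y s) /\
    Lam k (fun s => Phi s * y s) = Int (fun s => Phi s * y s * h s))).
  - move=> c A c0 mA _.
    have e : (fun s => Phi s * (c * \1_A s)) = (fun s => c * (Phi s * \1_A s)).
      by apply/funext => s; ring.
    rewrite e; split; first by apply: L1span_scale => //; exact: spanP.
    rewrite Lam_scale//; last exact: spanP.
    rewrite -/(Lam_mass k A) hA// -RintegralZl//.
      by congr Rintegral; apply/funext => s; ring.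
    by apply: iM; have [] := spanP mA.
  - move=> g1 g2 m1 m2 p1 p2 Q1 Q2 i12.
    have mg1 : measurable_fun setT (fun s : S => Phi s * g1 s).
      by apply: measurable_funM => //; exact: measurable_fun_gen m1.
    have mg2 : measurable_fun setT (fun s : S => Phi s * g2 s).
      by apply: measurable_funM => //; exact: measurable_fun_gen m2.
    have i1 : intg (fun s => Phi s * g1 s).
      apply: integrable_dom i12 => // s _.
      rewrite (ger0_norm (mulr_ge0 (P0 s) (p1 s))).
      by apply: ler_wpM2l; rewrite ?P0// lerDl p2.
    have i2 : intg (fun s => Phi s * g2 s).
      apply: integrable_dom i12 => // s _.
      rewrite (ger0_norm (mulr_ge0 (P0 s) (p2 s))).
      by apply: ler_wpM2l; rewrite ?P0// lerDr p1.
    have [s1 e1] := Q1 i1; have [s2 e2] := Q2 i2.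
    have e : (fun s => Phi s * (g1 s + g2 s)) = (fun s => Phi s * g1 s + Phi s * g2 s).
      by apply/funext => s; ring.
    rewrite e; split; first exact: L1span_add.
    rewrite Lam_add// e1 e2 -RintegralD//; [|exact: iM|exact: iM].
    by congr Rintegral; apply/funext => s; ring.
  move=> F g mF mg F0 ndF Fg QF ig.
  have Fle m s : F m s <= g s.
    have := Fg s; move/cvgP => cF; rewrite -(cvg_lim _ (Fg s))//.
    by apply: nondecreasing_cvgn_le => // a b ab; exact: ndF.
  have mPF m : measurable_fun setT (fun s : S => Phi s * F m s).
    by apply: measurable_funM => //; exact: measurable_fun_gen (mF m).
  have bF m s : `|Phi s * F m s| <= Phi s * g s.
    rewrite (ger0_norm (mulr_ge0 (P0 s) (F0 m s))).
    by apply: ler_wpM2l; rewrite ?P0.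
  have iF m : intg (fun s => Phi s * F m s) by exact: integrable_dom ig.
  have cF s : (Phi s * F m s) @[m --> \oo] --> Phi s * g s.
    by apply: cvgM; [exact: cvg_cst|exact: Fg].
  have [_ cv] := L1_dct ig mPF bF cF.
  have sg : L1span (fun s => Phi s * g s).
    apply: (L1span_dct iphi (F := fun m s => Phi s * F m s) ig) => // m.
    by have [] := QF m (iF m).
  split => //; apply/eqP; rewrite -subr_eq0 -normr_le0.
  apply: (@le_of_eps _ _ _ 2) => // e e0; rewrite add0r.
  move/cvgrPdist_le: cv => /(_ e e0) [N _ /(_ N (leqnn N)) /=].
  rewrite sub0r normrN ger0_norm ?L1dist_ge0// => hN.
  have [sN eN] := QF N (iF N).
  have h1 : `|Lam k (fun s => Phi s * g s) - Lam k (fun s => Phi s * F N s)| <= e.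
    have := Lam_dist iphi hl al suml k sg sN; rewrite L1distC => hd.
    exact: le_trans hd hN.
  have h2 : `|Int (fun s => Phi s * F N s * h s) - Int (fun s => Phi s * g s * h s)| <= e.
    rewrite -RintegralB//; [|exact: iM|exact: iM].
    apply: le_trans (le_normr_Rintegral measurableT _) _.
      by apply: integrable_sub => //; exact: iM.
    apply: le_trans hN; apply: le_Rintegral => //.
    + by apply: integrable_normr; apply: integrable_sub => //; exact: iM.
    + exact: integrable_dist.
    move=> s _; rewrite -mulrBl normrM ler_piMr//.
    by rewrite ger0_norm; case/andP: (h01 s).
  rewrite eN in h1.
  apply: le_trans (ler_distD (Int (fun s => Phi s * F N s * h s)) _ _) _.
  by apply: le_trans (lerD h1 h2) _; lra.
exists h; split => // H; pose y s := maxlin H (fun u => phi u s / Phi s).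
have my : measurable_fun setT (y : S' -> R).
  rewrite /y; elim: H {y} => [|p H IH].
    by under eq_fun do rewrite maxlin_nil; exact: measurable_cst.
  under eq_fun do rewrite maxlin_cons; apply: measurable_maxr => //.
  by apply: measurable_funM; [exact: measurable_cst|exact: measurable_quot].
have y0 s : 0 <= y s by exact: maxlin_ge0.
have aey : {ae mu, forall s : S, Phi s * y s = maxlin_phi H s}.
  apply: filterS tpos => s /(Phi_gt0 mu alpha) Ps.
  rewrite /y -maxlin_scale//; congr maxlin; apply/funext => u.
  by rewrite mulrCA divff ?mulr1// gt_eqF.
have mPy : measurable_fun setT (fun s : S => Phi s * y s).
  by apply: measurable_funM => //; exact: measurable_fun_gen my.
have iv : intg (maxlin_phi H) by exact: integrable_maxlin_fun.
have iPy : intg (fun s => Phi s * y s).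
  apply/integrableP; split; first exact/measurable_EFinP.
  rewrite (ae_eq_integral (fun s => `|(maxlin_phi H s)%:E|%E))//.
  - by have /integrableP[] := iv.
  - by apply/measurable_EFinP; apply: measurableT_comp.
  - apply/measurable_EFinP; apply: measurableT_comp => //.
    exact: integrable_measurable iv.
  - by apply: filterS aey => s /= ->.
have [_ e] := key y my y0 iPy.
have -> : Int (fun s => maxlin_phi H s * h s) = Int (fun s => Phi s * y s * h s).
  apply: Rintegral_ae_eq.
  - by apply: measurable_funM => //; exact: integrable_measurable iv.
  - exact: measurable_funM.
  - by apply: filterS aey => s ->.
rewrite -e.
have := Lam_near iphi hl al suml k [:: (1, H)] iPy.
have -> : vcomb phi [:: (1, H)] = maxlin_phi H.
  by apply/funext => s; rewrite /vcomb lin_cons lin_nil mul1r addr0.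
have -> : L1dist mu (fun s => Phi s * y s) (maxlin_phi H) = 0.
  rewrite /L1dist (@Rintegral_ae_eq _ _ _ mu _ (cst 0)).
  - by rewrite /Rintegral integral0.
  - apply: measurableT_comp => //; apply: measurable_funB => //.
    exact: integrable_measurable iv.
  - exact: measurable_cst.
  - by apply: filterS aey => s ->; rewrite subrr normr0.
rewrite lin_cons lin_nil mul1r addr0 normr_le0 subr_eq0 => /eqP ->.
by [].
Qed.

End density.

(** * Uniqueness of densities *)

Section uniqueness.
Context (R : realType) (T : eqType) (d : measure_display) (S : measurableType d).
Context (mu : {measure set S -> \bar R}) (f : T -> S -> R) (alpha : R).
Context (alpha_gt0 : 0 < alpha) (f0 : forall t s, 0 <= f t s).
Context (mf : forall t, measurable_fun setT (f t)).
Let phi t s := f t s `^ alpha.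
Context (iphi : forall t, mu.-integrable setT (EFin \o phi t)).
Context (full : full_support mu f).
Local Notation maxlin_phi := (maxlin_fun phi).
Local Notation Int g := (Rintegral mu setT g).
Local Notation intg g := (mu.-integrable setT (EFin \o g)).
Local Notation S' := (g_sigma_algebraType (family_gen (Defs.ratio f))).

Lemma integrable_mul_bounded (g h : S -> R) C : intg g -> measurable_fun setT h ->
  (forall s, `|h s| <= C) -> intg (fun s => g s * h s).
Proof.
move=> ig mh hC; apply: integrable_dom (integrable_scale measurableT C
  (integrable_normr ig)) => //.
  by apply: measurable_funM => //; exact: integrable_measurable ig.
by move=> s _; rewrite normrM mulrC ler_wpM2r.
Qed.

(** Test the equality of integrals on [phi t * \1_A] for [A = {h < h'}]: every
    [f t] vanishes a.e. on [A], so [A] is null by full support. *)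
Lemma density_ae_ge (h h' : S' -> R) C : measurable_fun setT h ->
  measurable_fun setT h' -> (forall s, `|h s - h' s| <= C) ->
  (forall H, Int (fun s => maxlin_phi H s * (h s - h' s)) = 0) ->
  {ae mu, forall s : S, h' s <= h s}.
Proof.
move=> mh mh' hC hv.
have mhS : measurable_fun setT (h : S -> R) by exact: (measurable_fun_gen f0 mf mh).
have mhS' : measurable_fun setT (h' : S -> R) by exact: (measurable_fun_gen f0 mf mh').
pose A : set S' := [set s | h s < h' s].
have mA : measurable A.
  by rewrite /A -[X in measurable X]setTI; apply: measurable_fun_ltr.
have mAS : measurable (A : set S) by exact: (measurable_gen f0 mf mA).
have mA0 : mu A = 0%E.
  apply/eqP; rewrite eq_le measure_ge0 andbT leNgt; apply/negP => A0.
  apply: full; exists A; split => // t.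
  have sp := L1span_ratio alpha_gt0 f0 iphi t mA.
  have i0 := L1span_density iphi mhS mhS' hC hv sp.
  have ig : intg (fun s => phi t s * \1_A s * (h s - h' s)).
    by apply: integrable_mul_bounded hC; [case: sp|exact: measurable_funB].
  have : {ae mu, forall s, (-1) * (phi t s * \1_A s * (h s - h' s)) = 0}.
    apply: Rintegral_le0_ae.
    - exact: integrable_scale.
    - move=> s; rewrite mulN1r -mulrN opprB indicE.
      have [hA|hA] := pselect (A s); last by rewrite memNset// mulr0 mul0r.
      by rewrite mem_set// mulr1 mulr_ge0 ?powR_ge0// subr_ge0 ltW.
    - by rewrite RintegralZl// i0 mulr0.
  apply: filterS => s + As.
  rewrite indicE mem_set// mulr1 mulN1r => /eqP.
  rewrite oppr_eq0 mulf_eq0 subr_eq0 (lt_eqF As) orbF powR_eq0.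
  by case/andP => /eqP.
exists A; split => // s /= /negP; rewrite -ltNge => hA; exact: hA.
Qed.

Lemma density_unique (h h' : S' -> R) C : measurable_fun setT h ->
  measurable_fun setT h' -> (forall s, `|h s| <= C) -> (forall s, `|h' s| <= C) ->
  (forall H, Int (fun s => maxlin_phi H s * h s) = Int (fun s => maxlin_phi H s * h' s)) ->
  {ae mu, forall s : S, h s = h' s}.
Proof.
move=> mh mh' hC hC' hv.
have mhS : measurable_fun setT (h : S -> R) by exact: (measurable_fun_gen f0 mf mh).
have mhS' : measurable_fun setT (h' : S -> R) by exact: (measurable_fun_gen f0 mf mh').
have iv H : intg (maxlin_phi H) by exact: integrable_maxlin_fun.
have bd s : `|h s - h' s| <= C + C by apply: le_trans (ler_normB _ _) (lerD _ _).
have bd' s : `|h' s - h s| <= C + C by rewrite distrC.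
have eqv H : Int (fun s => maxlin_phi H s * (h s - h' s)) = 0.
  rewrite (_ : (fun s => _) = fun s => maxlin_phi H s * h s - maxlin_phi H s * h' s); last first.
    by apply/funext => s; rewrite mulrBr.
  rewrite RintegralB ?hv ?subrr//.
    exact: integrable_mul_bounded (iv H) mhS hC.
  exact: integrable_mul_bounded (iv H) mhS' hC'.
have eqv' H : Int (fun s => maxlin_phi H s * (h' s - h s)) = 0.
  rewrite (_ : (fun s => _) = fun s => maxlin_phi H s * h' s - maxlin_phi H s * h s); last first.
    by apply/funext => s; rewrite mulrBr.
  rewrite RintegralB ?hv ?subrr//.
    exact: integrable_mul_bounded (iv H) mhS' hC'.
  exact: integrable_mul_bounded (iv H) mhS hC.
apply: filterS2 (density_ae_ge mh mh' bd eqv) (density_ae_ge mh' mh bd' eqv').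
by move=> s a b; apply/le_anti; rewrite a b.
Qed.

End uniqueness.
Unset Strict Implicit.
Unset Printing Implicit Defensive.

(** * Exponents of Frechet processes *)

Section exponent.
Context (R : realType) (T : eqType) (d : measure_display) (O : measurableType d).
Context (P : probability O R) (alpha : R) (alpha_gt0 : 0 < alpha).
Implicit Types (H : form R T) (K : seq (T * R)).

(** [maxlin H (Y ^ alpha) <= 1] means that [Y t <= u ^ (- 1 / alpha)] for the pairs
    [(t, u)] of [H] with [u > 0]; the others impose nothing on a nonnegative
    process. *)
Definition thresholds H : seq (T * R) :=
  [seq (p.1, p.2 `^ (- alpha^-1)) | p <- H & 0 < p.2].

Definition below (Y : T -> O -> R) K : set O :=
  [set w | all (fun p => Y p.1 w <= p.2) K].

(** The positive part only matters on a null event, but it makes the equivalence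
    [orth_thresholds] hold at every point of the probability space. *)
Definition pos_powR (Y : T -> O -> R) (w : O) (t : T) : R := Num.max (Y t w) 0 `^ alpha.

Lemma powRK (u : R) : 0 <= u -> (u `^ (- alpha^-1)) `^ alpha = u^-1.
Proof.
by move=> u0; rewrite -powRrM mulNr mulVf ?gt_eqF// powR_inv1.
Qed.

Lemma powR_invK (u : R) : 0 <= u -> (u `^ (- alpha)) `^ (- alpha^-1) = u.
Proof.
by move=> u0; rewrite -powRrM mulrNN mulfV ?gt_eqF// powRr1.
Qed.

Lemma orth_thresholds Y H w : orth H (pos_powR Y w) = all (fun p => Y p.1 w <= p.2) (thresholds H).
Proof.
elim: H => [|p H IH]; first by rewrite orth_nil.
have -> : orth (p :: H) (pos_powR Y w) = (p.2 * pos_powR Y w p.1 <= 1) && orth H (pos_powR Y w).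
  by rewrite /orth maxlin_cons ge_max.
rewrite IH /thresholds /=; have [p0|p0] := ltP 0 p.2 => /=; last first.
  rewrite (_ : _ <= 1)//; apply: le_trans ler01.
  by rewrite mulr_le0_ge0// powR_ge0.
congr (_ && _); rewrite -ler_pdivlMl// mulr1 -(powRK (ltW p0)) /pos_powR.
set y := _ `^ (- _); have y0 : 0 < y by exact: powR_gt0.
have m0 : 0 <= Num.max (Y p.1 w) 0 by rewrite le_max lexx orbT.
apply/idP/idP => [|h].
  apply: contraTT; rewrite -!ltNge => yY; apply: gt0_ltr_powR => //.
  - by rewrite nnegrE ltW.
  - by rewrite lt_max yY.
by apply: ge0_ler_powR; rewrite ?nnegrE ?(ltW alpha_gt0)// ?(ltW y0)// ge_max h ltW.
Qed.

Lemma thresholds_dilate z H : 0 < z ->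
  thresholds (dilate z H) = [seq (p.1, z `^ (- alpha^-1) * p.2) | p <- thresholds H].
Proof.
move=> z0; elim: H => //= p H IH; rewrite /thresholds /= in IH *.
rewrite pmulr_rgt0//; case: ifP => //= p0.
by rewrite IH powRM// ltW.
Qed.

Lemma thresholds_gt0 H : all (fun p => 0 < p.2) (thresholds H).
Proof.
rewrite /thresholds all_map; elim: H => //= p H IH; case: ifP => //= p0.
by rewrite IH powR_gt0.
Qed.

Lemma vmax_le m (x : 'I_m.+1 -> R) y : (vmax x <= y) = [forall i, x i <= y].
Proof.
rewrite /vmax; apply/bigmax_leP/forallP => [[_ h] i|h]; first exact: h.
by split => [|i _]; exact: h.
Qed.

Lemma frechet_below Y K : frechet_process P alpha Y ->
  all (fun p => 0 < p.2) K -> exists c, [/\ 0 <= c, K != [::] -> 0 < c &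
    forall z : R, 0 < z -> P (below Y [seq (p.1, z * p.2) | p <- K]) =
      (expR (- (c * z `^ (- alpha))))%:E].
Proof.
case: K => [|p0 K] hY K0.
  exists 0; split => // z _; rewrite mul0r oppr0 expR0.
  by rewrite (_ : below _ _ = setT) ?probability_setT//; apply/seteqP; split.
pose L := p0 :: K.
have nL (i : 'I_(size K).+1) : 0 < (nth p0 L i).2.
  by apply: (all_nthP p0 K0); exact: (ltn_ord i).
have [|//|s s0 hs] := hY (size K) (fun i => (nth p0 L i).1) (fun i => (nth p0 L i).2^-1).
- by move=> i; rewrite invr_ge0 ltW.
- by exists ord0; rewrite invr_gt0.
exists (s `^ alpha); split => //; first exact: powR_ge0.
  by move=> _; exact: powR_gt0.
move=> z z0; rewrite -hs//; congr (P _); apply/seteqP; split => w /=.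
  move=> h; rewrite vmax_le; apply/forallP => i.
  rewrite ler_pdivrMl// mulrC.
  have hi : (i < size [seq (p.1, (z * p.2)%R) | p <- L])%N.
    by rewrite size_map; exact: (ltn_ord i).
  have : (fun p => Y p.1 w <= p.2) (nth p0 [seq (p.1, (z * p.2)%R) | p <- L] i).
    exact: (all_nthP p0 h).
  by rewrite (nth_map p0)//; exact: (ltn_ord i).
rewrite vmax_le => /forallP h.
suff : all (fun p => Y p.1 w <= p.2) [seq (p.1, (z * p.2)%R) | p <- L] by [].
apply/(all_nthP p0) => i; rewrite size_map => iL; rewrite (nth_map p0)//=.
have := h (Ordinal (iL : (i < (size K).+1)%N)).
by rewrite /= ler_pdivrMl ?(nL (Ordinal (iL : (i < (size K).+1)%N)))// mulrC.
Qed.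

Context (Y : T -> O -> R) (mY : forall t, measurable_fun setT (Y t)).

Lemma measurable_below K : measurable (below Y K).
Proof.
elim: K => [|p K IH].
  by rewrite (_ : below Y [::] = setT)//; apply/seteqP; split.
rewrite (_ : below Y _ = [set w | Y p.1 w <= p.2] `&` below Y K).
  apply: measurableI => //; rewrite -[X in measurable X]setTI.
  exact: measurable_fun_ler.
by apply/seteqP; split => w /=; rewrite /below /=; [move/andP|move=> [-> ->]].
Qed.

Context (hY : frechet_process P alpha Y).

Lemma frechet_form H : exists c : R, [/\ 0 <= c, thresholds H != [::] -> 0 < c &
  forall z : R, 0 < z -> P (below Y (thresholds (dilate z H))) = (expR (- (c * z)))%:E].
Proof.
have [c [c0 cp hc]] := frechet_below hY (thresholds_gt0 H).
exists c; split => // z z0; rewrite thresholds_dilate// hc ?powR_gt0//.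
by rewrite -powRrM mulrNN mulVf ?gt_eqF// powRr1// ltW.
Qed.

Lemma expRN_bound (y : R) : 0 <= y -> 1 - y <= expR (- y) <= 1 - y + y ^+ 2.
Proof.
move=> y0; rewrite expR_ge1Dx /= expRN.
have h : 1 + y <= expR y by exact: expR_ge1Dx.
have h1 : 0 < 1 + y by lra.
apply: le_trans (_ : (1 + y)^-1 <= _).
  by rewrite lef_pV2 ?posrE// expR_gt0.
rewrite -[leLHS]mul1r ler_pdivrMr// expr2.
have : 0 <= y * (y * y) by rewrite !mulr_ge0.
lra.
Qed.

(** The scale parameters of the max-linear combinations give [l], and their common
    power law gives homogeneity.  For alternation, the expectation of the
    combination of the orthants dilated by [z] is the combination of the
    [exp (- z * l H)], hence nonnegative; as [z] tends to [0] its expansion is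
    [- z * lin l A] up to a multiple of [z ^+ 2], because the total mass is [0]. *)
Lemma exponent_exists : exists l : form R T -> R,
  [/\ homogeneous l, alternating l,
      (forall H, P (below Y (thresholds H)) = (expR (- l H))%:E) &
      forall H, thresholds H != [::] -> 0 < l H].
Proof.
have [l hl] := choice frechet_form.
have l0 H : 0 <= l H by have [] := hl H.
have lE z H : 0 < z -> P (below Y (thresholds (dilate z H))) = (expR (- (l H * z)))%:E.
  by move=> z0; have [_ _ ->] := hl H.
have lE1 H : P (below Y (thresholds H)) = (expR (- l H))%:E.
  rewrite -[in RHS](mulr1 (l H)) -lE//; congr (P (below Y (thresholds _))).
  by rewrite /dilate -[LHS]map_id; apply: eq_map => -[a b]; rewrite mul1r.
exists l; split => //; last by move=> H; have [] := hl H.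
  move=> z H z0; have := lE1 (dilate z H); rewrite lE// => -[/expR_inj e].
  by apply: oppr_inj; rewrite -e mulrC.
move=> A A0 Ax.
pose C := \sum_(p <- A) `|p.1| * (l p.2) ^+ 2.
have C0 : 0 <= C by apply: sumr_ge0 => p _; rewrite mulr_ge0// sqr_ge0.
apply: (@le_of_eps _ _ _ C C0) => z z0; rewrite add0r.
have h1 : 0 <= lin (fun H => expR (- (l H * z))) A.
  pose g B w : R := lin (fun H => (orth (dilate z H) (pos_powR Y w))%:R) B.
  have gE B : P.-integrable setT (EFin \o g B) /\
     Rintegral P setT (g B) = lin (fun H => expR (- (l H * z))) B.
    elim: B => [|p B [iB eB]].
      rewrite (_ : g [::] = cst 0); last by apply/funext => w; rewrite /g lin_nil.
      by split; [exact: integrable0|rewrite lin_nil /Rintegral integral0].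
    have mb := measurable_below (thresholds (dilate z p.2)).
    have -> : g (p :: B) = fun w => p.1 * \1_(below Y (thresholds (dilate z p.2))) w + g B w.
      apply/funext => w; rewrite /g lin_cons; congr (_ * _ + _).
      by rewrite indicE orth_thresholds mem_setE.
    have i1 : P.-integrable setT (EFin \o (\1_(below Y (thresholds (dilate z p.2))) : O -> R)).
      apply: (@integrable_dom _ _ _ _ _ _ _ (cst 1)) => //.
      - by move=> w _; rewrite indicE; case: (w \in _); rewrite ?normr0 ?normr1.
      - exact: finite_measure_integrable_cst.
    split; first by apply: integrable_add => //; exact: integrable_scale.
    rewrite RintegralD//; last exact: integrable_scale.
    rewrite RintegralZl// eB lin_cons; congr (_ * _ + _).
    rewrite /Rintegral integral_indic// setIT.
    exact: (congr1 fine (lE z p.2 z0)).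
  have [_ <-] := gE A; apply: Rintegral_ge0 => w _; rewrite /g.
  rewrite (_ : (fun H => _) = fun H => (orth H (fun t => z * pos_powR Y w t))%:R); last first.
    by apply/funext => H; rewrite /orth maxlin_dilate ?(ltW z0)// maxlin_scale ?(ltW z0).
  by apply: Ax => t; rewrite mulr_ge0 ?powR_ge0// ltW.
have h2 : lin (fun H => expR (- (l H * z))) A <= lin (fun=> 1) A - z * lin l A + z ^+ 2 * C.
  rewrite /lin /C !mulr_sumr -sumrB -big_split /=; apply: ler_sum => p _.
  have /expRN_bound/andP[b1 b2] : 0 <= l p.2 * z by rewrite mulr_ge0// ltW.
  set q := l p.2 in b1 b2 *.
  have [p0|p0] := leP 0 p.1.
    apply: le_trans (ler_wpM2l p0 b2) _; rewrite ger0_norm//.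
    rewrite le_eqVlt; apply/orP; left; apply/eqP; ring.
  apply: le_trans (ler_wnM2l (ltW p0) b1) _.
  rewrite (_ : p.1 * (1 - q * z) = p.1 * 1 - z * (p.1 * q)); last by ring.
  by rewrite lerDl mulr_ge0 ?sqr_ge0// mulr_ge0 ?sqr_ge0.
rewrite A0 in h2; rewrite -(ler_pM2l z0).
have -> : z * (C * z) = z ^+ 2 * C by ring.
lra.
Qed.

End exponent.

(** * Finite-dimensional distributions and orthants *)

Section boxes.
Context (R : realType) (m : nat).

Definition box (L : seq ('I_m * R)) : set (m.-tuple R) :=
  [set v | all (fun q => tnth v q.1 <= q.2) L].

Lemma box_cat L L' : box (L ++ L') = box L `&` box L'.
Proof.
by apply/seteqP; split => v; rewrite /box /= all_cat; [move/andP|move=> [-> ->]].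
Qed.

Lemma measurable_box L : measurable (box L).
Proof.
elim: L => [|q L IH].
  by rewrite (_ : box [::] = setT)//; apply/seteqP; split.
rewrite -cat1s box_cat; apply: measurableI => //.
rewrite (_ : box _ = [set v | tnth v q.1 <= q.2]).
  rewrite -[X in measurable X]setTI; apply: measurable_fun_ler => //.
  exact: measurable_tnth.
by apply/seteqP; split => v; rewrite /box /= andbT.
Qed.

(** The converse of [measurable_box]: boxes generate the product sigma-algebra. *)
Lemma sub_sigma_box (B : set (m.-tuple R)) : measurable B -> <<s range box >> B.
Proof.
apply: smallest_sub; first exact: smallest_sigma_algebra.
move=> A; rewrite -bigcup_seq => -[i /= _ [Y mY <-]]; rewrite setTI.
pose V := g_sigma_algebraType (range box).
have mi : measurable_fun setT ((fun v => tnth v i) : V -> R).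
  apply: measurable_fun_le => b; apply: sub_sigma_algebra.
  by exists [:: (i, b)] => //; apply/seteqP; split => v; rewrite /box /= andbT.
by have := mi measurableT Y mY; rewrite setTI.
Qed.

End boxes.

Section fdd.
Context (R : realType) (T : eqType).
Context (d1 : measure_display) (O1 : measurableType d1) (P1 : probability O1 R).
Context (d2 : measure_display) (O2 : measurableType d2) (P2 : probability O2 R).
Context (X1 : T -> O1 -> R) (X2 : T -> O2 -> R).

Lemma eq_fdd_below : eq_fdd P1 X1 P2 X2 ->
  forall K, P1 (below X1 K) = P2 (below X2 K).
Proof.
move=> h K; pose t := map_tuple fst (in_tuple K).
pose L := [seq (i, (tnth (in_tuple K) i).2) | i <- enum 'I_(size K)].
have E d (O : measurableType d) (X : T -> O -> R) :
    below X K = [set w | box L [tuple X (tnth t i) w | i < size K]].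
  apply/seteqP; split => w /=; rewrite /below /box /= all_map.
    move=> /(all_tnthP (t := in_tuple K)) hK; apply/allP => i _ /=.
    by rewrite tnth_mktuple tnth_map; exact: hK.
  move=> /allP hL; apply/(all_tnthP (t := in_tuple K)) => i.
  by have := hL i (mem_enum _ i); rewrite /= tnth_mktuple tnth_map.
by rewrite !E; apply: h; exact: measurable_box.
Qed.

Context (mX1 : forall t, measurable_fun setT (X1 t)).
Context (mX2 : forall t, measurable_fun setT (X2 t)).

(** Orthants form a pi-system that generates the sigma-algebra of tuples.  The
    hypothesis on small thresholds says that [X1] is a.s. positive; it passes to
    [X2], and orthants with a threshold that is not positive are then null for
    both processes. *)
Lemma eq_fdd_of_below :
  (forall K, all (fun p => 0 < p.2) K -> P1 (below X1 K) = P2 (below X2 K)) ->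
  (forall t e, 0 < e -> exists2 y : R, 0 < y & (P1 (below X1 [:: (t, y)]) <= e%:E)%E) ->
  eq_fdd P1 X1 P2 X2.
Proof.
move=> hK small.
have null d (O : measurableType d) (P : probability O R) (X : T -> O -> R)
    (mX : forall t, measurable_fun setT (X t)) :
    (forall t e, 0 < e -> exists2 y : R, 0 < y & (P (below X [:: (t, y)]) <= e%:E)%E) ->
    forall K, ~~ all (fun p => 0 < p.2) K -> P (below X K) = 0%E.
  move=> sm K; rewrite -has_predC => /hasP[p pK /=]; rewrite -leNgt => p0.
  apply/eqP; rewrite eq_le measure_ge0 andbT; apply/lee_addgt0Pr => e e0.
  rewrite add0e; have [y y0 hy] := sm p.1 e e0; apply: le_trans hy.
  apply: le_measure; rewrite ?inE; [exact: measurable_below..|].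
  move=> w /allP /(_ p pK) /= h; rewrite /below /= andbT.
  by apply: le_trans h _; exact: le_trans p0 (ltW y0).
have hK' K : P1 (below X1 K) = P2 (below X2 K).
  have [h|h] := boolP (all (fun p => 0 < p.2) K); first exact: hK.
  rewrite (null _ _ _ _ mX1 small)// (null _ _ _ _ mX2)// => t e e0.
  by have [y y0 hy] := small t e e0; exists y => //; rewrite -hK//= y0.
move=> m t.
pose F d (O : measurableType d) (X : T -> O -> R) w : m.-tuple R :=
  [tuple X (tnth t i) w | i < m].
have mF d (O : measurableType d) (X : T -> O -> R) :
    (forall t, measurable_fun setT (X t)) -> forall B, measurable B ->
    measurable (F d O X @^-1` B).
  move=> mX B mB; rewrite -[X in measurable X]setTI.
  have : measurable_fun setT (F d O X).
    apply/measurable_fun_tnthP => i.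
    rewrite (_ : _ \o _ = X (tnth t i))//.
    by apply/funext => w /=; rewrite tnth_mktuple.
  by apply.
pose D := [set B : set (m.-tuple R) | measurable B /\
  P1 (F _ _ X1 @^-1` B) = P2 (F _ _ X2 @^-1` B)].
move=> B mB; suff [] : D B by [].
have sB := sub_sigma_box mB; move: B sB {mB}.
have boxI : setI_closed (range (@box R m)).
  by move=> _ _ [L _ <-] [L' _ <-]; exists (L ++ L') => //; rewrite box_cat.
have lD : lambda_system setT D.
  split => //.
  + by split => //; rewrite !preimage_setT !probability_setT.
  + move=> A B BA [mA eA] [mB eB]; split; first exact: measurableD.
    have dE d (O : measurableType d) (P : probability O R) X :
        (forall t, measurable_fun setT (X t)) ->
        P (F d O X @^-1` (A `\` B)) = (P (F d O X @^-1` A) - P (F d O X @^-1` B))%E.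
      move=> mX; rewrite (_ : _ @^-1` (A `\` B) = (F d O X @^-1` A) `\` (F d O X @^-1` B))// measureD.
      * by rewrite setIidr//; move=> w; exact: BA.
      * exact: mF.
      * exact: mF.
      * by rewrite ltey_eq fin_num_measure//; exact: mF.
    by rewrite !dE// eA eB.
  + move=> G ndG hG; split; first by apply: bigcupT_measurable => i; have [] := hG i.
    have cvg d (O : measurableType d) (P : probability O R) X :
        (forall t, measurable_fun setT (X t)) ->
        P (F d O X @^-1` (G i)) @[i --> \oo] --> P (F d O X @^-1` (\bigcup_i G i)).
      move=> mX; rewrite preimage_bigcup; apply: nondecreasing_cvg_mu.
      * by move=> i; apply: mF => //; have [] := hG i.
      * by apply: bigcupT_measurable => i; apply: mF => //; have [] := hG i.
      * move=> i j ij; apply/subsetPset => w /=.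
        by move: (ndG _ _ ij) => /subsetPset; exact.
    have c1 := cvg _ _ P1 X1 mX1; have c2 := cvg _ _ P2 X2 mX2.
    have e : (fun i => P1 (F _ _ X1 @^-1` (G i))) = (fun i => P2 (F _ _ X2 @^-1` (G i))).
      by apply/funext => i; have [] := hG i.
    by rewrite e in c1; exact: (cvg_unique _ c1 c2).
apply: (lambda_system_subset boxI lD) => //.
move=> _ [L _ <-]; split; first exact: measurable_box.
have E d (O : measurableType d) (X : T -> O -> R) :
    F d O X @^-1` (box L) = below X [seq (tnth t q.1, q.2) | q <- L].
  apply/seteqP; split => w; rewrite /below /box /= all_map.
    by move=> h; apply: sub_all h => q /=; rewrite tnth_mktuple.
  by move=> h; apply: sub_all h => q /=; rewrite tnth_mktuple.
by rewrite !E.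
Qed.

End fdd.

(** * Extremal integrals *)

Section Lplus.
Context (R : realType) (d : measure_display) (S : measurableType d).
Context (mu : {measure set S -> \bar R}) (alpha : R) (alpha_gt0 : 0 < alpha).
Implicit Types g r : S -> R.

Lemma Lplus_measurable g : Lplus mu alpha g -> measurable_fun setT g.
Proof. by move=> [+ _]; rewrite inE => /andP[/[!inE]]. Qed.

Lemma Lplus_integrable g : Lplus mu alpha g ->
  mu.-integrable setT (EFin \o (fun s => g s `^ alpha)).
Proof.
move=> Lg; have mg := Lplus_measurable Lg; case: Lg => + g0.
rewrite inE => /andP[_ /[!inE] lpg].
apply/integrableP; split.
  by apply/measurable_EFinP; exact: (measurableT_comp (measurable_powR alpha) mg).
move: lpg => /(poweR_lty alpha); rewrite powR_Lnorm ?gt_eqF//.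
apply: le_lt_trans.
rewrite le_eqVlt; apply/orP; left; apply/eqP; apply: eq_integral => s _ /=.
by rewrite !ger0_norm ?powR_ge0.
Qed.

Lemma Lplus_scale r g : measurable_fun setT r -> (forall s, 0 <= r s <= 1) ->
  Lplus mu alpha g -> Lplus mu alpha (fun s => r s * g s).
Proof.
move=> mr r01 Lg; have ig := Lplus_integrable Lg; have mg := Lplus_measurable Lg.
have g0 : forall s, 0 <= g s by case: Lg.
have rg0 s : 0 <= r s * g s by rewrite mulr_ge0//; case/andP: (r01 s).
have mrg : measurable_fun setT (fun s => r s * g s) by exact: measurable_funM.
split => //; rewrite inE; apply/andP; split; rewrite inE//=.
have irg : mu.-integrable setT (EFin \o (fun s => (r s * g s) `^ alpha)).
  apply: integrable_dom ig => //.
    exact: (measurableT_comp (measurable_powR alpha) mrg).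
  move=> s _; rewrite ger0_norm ?powR_ge0// powR_le_iff//.
  by rewrite ler_piMl//; case/andP: (r01 s).
rewrite /finite_norm unlock /=; apply: poweR_lty.
have /integrableP[_] := irg; apply: le_lt_trans.
rewrite le_eqVlt; apply/orP; left; apply/eqP; apply: eq_integral => s _ /=.
by rewrite !ger0_norm ?powR_ge0.
Qed.

End Lplus.

Section extremal.
Context (R : realType) (T : eqType) (d : measure_display) (S : measurableType d).
Context (mu : {measure set S -> \bar R}) (alpha : R) (alpha_gt0 : 0 < alpha).
Context (dM : measure_display) (OM : measurableType dM) (PM : probability OM R).
Context (I : (S -> R) -> OM -> R) (hI : is_extremal_integral mu alpha PM I).

Lemma maxlin_leP (H : form R T) x z : 0 <= z ->
  (maxlin H x <= z) = all (fun p => p.2 * x p.1 <= z) H.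
Proof.
move=> z0; elim: H => [|p H IH] /=; first by rewrite maxlin_nil.
by rewrite maxlin_cons ge_max IH.
Qed.

Lemma powR_div_thresholds (a u : R) : 0 <= a -> 0 < u ->
  (a / u `^ (- alpha^-1)) `^ alpha = u * a `^ alpha.
Proof.
move=> a0 u0; rewrite powRM ?invr_ge0 ?powR_ge0// mulrC; congr (_ * _).
by rewrite -powRN opprK -powRrM mulVf ?gt_eqF// powRr1// ltW.
Qed.

(** The passage between the maximum of the [g t / y] that defines extremal
    integrals and max-linear forms in [g ^ alpha]. *)
Lemma vmax_thresholds (H : form R T) p0 K (g : T -> R) : (forall t, 0 <= g t) ->
  thresholds alpha H = p0 :: K ->
  vmax (fun i : 'I_(size K).+1 => g (nth p0 (p0 :: K) i).1 / (nth p0 (p0 :: K) i).2)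
    `^ alpha = maxlin H (fun t => g t `^ alpha).
Proof.
move=> g0 HK; set x := fun i : 'I_ _ => _.
have nK (i : 'I_(size K).+1) : nth p0 (p0 :: K) i \in p0 :: K.
  by apply: mem_nth; exact: ltn_ord.
have x0 i : 0 <= x i.
  apply: divr_ge0 => //; have /allP := thresholds_gt0 alpha H; rewrite HK.
  by move=> /(_ _ (nK i)) /ltW.
have xle i : x i `^ alpha <= maxlin H (fun t => g t `^ alpha).
  have : nth p0 (p0 :: K) i \in thresholds alpha H by rewrite HK.
  move=> /mapP[q]; rewrite mem_filter => /andP[q0 qH] e.
  rewrite /x e /= powR_div_thresholds//.
  have := lexx (maxlin H (fun t => g t `^ alpha)).
  by rewrite maxlin_leP ?maxlin_ge0// => /allP /(_ q qH).
have v0 : 0 <= vmax x.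
  by apply: le_trans (x0 ord0) _; have := lexx (vmax x); rewrite vmax_le => /forallP.
set v := maxlin _ _ in xle *; have vv : 0 <= v by exact: maxlin_ge0.
have zE : (v `^ alpha^-1) `^ alpha = v by rewrite -powRrM mulVf ?gt_eqF// powRr1.
apply/le_anti/andP; split.
  rewrite -[leRHS]zE powR_le_iff ?powR_ge0// vmax_le; apply/forallP => i.
  by rewrite -(powR_le_iff alpha_gt0) ?powR_ge0// zE.
rewrite maxlin_leP ?powR_ge0//; apply/allP => q qH.
have [q0|q0] := ltP 0 q.2; last first.
  by apply: le_trans (powR_ge0 _ _); rewrite mulr_le0_ge0// powR_ge0.
have qK : (q.1, q.2 `^ (- alpha^-1)) \in p0 :: K.
  by rewrite -HK; apply/mapP; exists q => //; rewrite mem_filter q0.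
have qi : (index (q.1, q.2 `^ (- alpha^-1)) (p0 :: K) < (size K).+1)%N.
  by rewrite -[X in (_ < X)%N]/(size (p0 :: K)) index_mem.
pose i := Ordinal qi.
have := lexx (vmax x); rewrite vmax_le => /forallP /(_ i).
rewrite -(powR_le_iff alpha_gt0)//; apply: le_trans.
by rewrite /x /i /= nth_index//= powR_div_thresholds.
Qed.

Lemma extremal_below (g : T -> S -> R) (H : form R T) :
  (forall t, Lplus mu alpha (g t)) ->
  PM (below (fun t => I (g t)) (thresholds alpha H)) =
  (expR (- Rintegral mu setT (maxlin_fun (fun t s => g t s `^ alpha) H)))%:E.
Proof.
move=> Lg; have g0 t s : 0 <= g t s by case: (Lg t).
case HK : (thresholds alpha H) => [|p0 K].
  rewrite (_ : below _ _ = setT); last by apply/seteqP; split.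
  rewrite probability_setT (_ : maxlin_fun _ _ = cst 0).
    by rewrite /Rintegral integral0 oppr0 expR0.
  apply/funext => s; apply/le_anti; rewrite maxlin_ge0 andbT /maxlin_fun maxlin_leP//.
  apply/allP => q qH; have [q0|q0] := ltP 0 q.2; last first.
    by rewrite mulr_le0_ge0// powR_ge0.
  have : (q.1, q.2 `^ (- alpha^-1)) \in thresholds alpha H.
    by apply/mapP; exists q => //; rewrite mem_filter q0.
  by rewrite HK.
have [_ /(_ (size K) (fun i => g (nth p0 (p0 :: K) i).1)
  (fun i => (nth p0 (p0 :: K) i).2))] := hI.
have y0 (i : 'I_(size K).+1) : 0 < (nth p0 (p0 :: K) i).2.
  have /allP := thresholds_gt0 alpha H; rewrite HK.
  by apply; apply: mem_nth; exact: ltn_ord.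
move=> /(_ (fun i => Lg _) y0) e.
have -> : below (fun t => I (g t)) (p0 :: K) =
    [set w | forall i : 'I_(size K).+1, I (g (nth p0 (p0 :: K) i).1) w <=
      (nth p0 (p0 :: K) i).2].
  apply/seteqP; split => w.
    by move=> h i; exact: (all_nthP p0 h).
  move=> h; apply/(all_nthP p0) => i iK.
  exact: (h (Ordinal (iK : (i < (size K).+1)%N))).
rewrite e.
have -> : (\int[mu]_s (vmax (fun i : 'I_(size K).+1 =>
    (g (nth p0 (p0 :: K) i).1 s / (nth p0 (p0 :: K) i).2)) `^ alpha)%:E)%E =
    (\int[mu]_s (maxlin_fun (fun t s => g t s `^ alpha) H s)%:E)%E.
  by apply: eq_integral => s _; rewrite (vmax_thresholds (g := fun t => g t s) _ HK).
have ig : mu.-integrable setT (EFin \o (maxlin_fun (fun t s => g t s `^ alpha) H)).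
  by apply: integrable_maxlin_fun => t; exact: Lplus_integrable.
by rewrite -(fineK (integrable_fin_num measurableT ig)).
Qed.

End extremal.

(** * Maxima of independent processes *)

Section independence.
Context (R : realType) (T : eqType) (d : measure_display) (O : measurableType d).

Lemma sigma_family_below (Y : T -> O -> R) K : sigma_family Y (below Y K).
Proof.
pose V := g_sigma_algebraType (family_gen Y).
suff : @measurable _ V (below Y K) by [].
apply: (@measurable_below R T _ V Y) => t _ B mB; rewrite setTI.
by apply: sub_sigma_algebra; exists t => //; exists B => //; rewrite setTI.
Qed.

Context (P : probability O R) (n : nat) (Yk : 'I_n.+1 -> T -> O -> R).

Lemma below_vmax K :
  below (fun t w => vmax (fun k => Yk k t w)) K = \bigcap_k below (Yk k) K.
Proof.
apply/seteqP; split => w.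
  move=> /allP h k _; apply/allP => p pK.
  by have := h p pK; rewrite vmax_le => /forallP /(_ k).
move=> h; apply/allP => p pK; rewrite vmax_le; apply/forallP => k.
by have /allP := h k I; exact.
Qed.

Lemma independent_below K : independent_processes P Yk ->
  P (below (fun t w => vmax (fun k => Yk k t w)) K) =
  (\prod_(k < n.+1) P (below (Yk k) K))%E.
Proof.
by move=> h; rewrite below_vmax h// => k; exact: sigma_family_below.
Qed.

End independence.

Section frechet_fdd.
Context (R : realType) (T : eqType) (alpha : R) (alpha_gt0 : 0 < alpha).

Lemma thresholds_form K : all (fun p : T * R => 0 < p.2) K ->
  exists H : form R T, thresholds alpha H = K.
Proof.
move=> K0; exists [seq (p.1, p.2 `^ (- alpha)) | p <- K].
elim: K K0 => //= p K IH /andP[p0 K0].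
rewrite /thresholds /= powR_gt0//= -/(thresholds _ _) IH// powR_invK ?ltW//.
by case: p {p0}.
Qed.

Lemma frechet_small (d : measure_display) (O : measurableType d)
    (P : probability O R) (Y : T -> O -> R) t e :
  frechet_process P alpha Y -> 0 < e ->
  exists2 y : R, 0 < y & (P (below Y [:: (t, y)]) <= e%:E)%E.
Proof.
move=> hY e0.
have [|c [_ /(_ isT) c0 hc]] := frechet_below (K := [:: (t, 1)]) hY.
  by rewrite /= ltr01.
exists ((c * e) ^-1 `^ (- alpha^-1)).
  by rewrite powR_gt0// invr_gt0 mulr_gt0.
have := hc ((c * e) ^-1 `^ (- alpha^-1)); rewrite /= mulr1 => ->; last first.
  by rewrite powR_gt0// invr_gt0 mulr_gt0.
rewrite lee_fin -powRrM mulrNN mulVf ?gt_eqF// powRr1; last first.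
  by rewrite invr_ge0 mulr_ge0 ?ltW.
rewrite invfM mulrA divff ?gt_eqF// mul1r expRN -[leRHS]invrK.
rewrite lef_pV2 ?posrE ?invr_gt0 ?expR_gt0//.
by have := @expR_ge1Dx R e^-1; lra.
Qed.

End frechet_fdd.

(** * The decomposition *)

Lemma Rintegral_sum (R : realType) (d : measure_display) (S : measurableType d)
    (mu : {measure set S -> \bar R}) (J : Type) (s : seq J) (g : J -> S -> R) :
  (forall k, mu.-integrable setT (EFin \o g k)) ->
  Rintegral mu setT (fun x => \sum_(k <- s) g k x) =
  \sum_(k <- s) Rintegral mu setT (g k).
Proof.
move=> ig; elim: s => [|k s IH].
  rewrite big_nil (_ : (fun x => _) = cst 0) ?/Rintegral ?integral0//.
  by apply/funext => x; rewrite big_nil.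
rewrite big_cons -IH -RintegralD//.
  by congr Rintegral; apply/funext => x; rewrite big_cons.
rewrite (_ : EFin \o _ = fun x => (\sum_(k <- s) (EFin \o g k) x)%E).
  exact: integrable_sum.
by apply/funext => x /=; rewrite sumEFin.
Qed.

Lemma measurable_vmax (R : realType) (d : measure_display) (O : measurableType d)
    (m : nat) (g : 'I_m.+1 -> O -> R) : (forall k, measurable_fun setT (g k)) ->
  measurable_fun setT (fun w => vmax (fun k => g k w)).
Proof.
move=> mg; rewrite /vmax; elim: (index_enum _) => [|k s IH].
  by under eq_fun do rewrite big_nil; exact: mg.
by under eq_fun do rewrite big_cons; exact: measurable_maxr.
Qed.

Section densities.
Context (R : realType) (T : eqType) (d : measure_display) (S : measurableType d).
Context (mu : {measure set S -> \bar R}) (f : T -> S -> R) (alpha : R).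
Context (alpha_gt0 : 0 < alpha) (f0 : forall t s, 0 <= f t s).
Context (mf : forall t, measurable_fun setT (f t)).
Let phi t s := f t s `^ alpha.
Context (iphi : forall t, mu.-integrable setT (EFin \o phi t)).
Context (hmu : sigma_finite setT mu) (full : full_support mu f).
Context (n : nat) (l : 'I_n.+1 -> form R T -> R).
Context (hl : forall k, homogeneous (l k)) (al : forall k, alternating (l k)).
Context (suml : forall H, \sum_k l k H = Rintegral mu setT (maxlin_fun phi H)).

(** Without indices every form is empty and the densities are arbitrary;
    otherwise a countable subfamily of [f] has full support and
    [density_exists] applies. *)
Lemma densities : exists h : 'I_n.+1 -> S -> R,
  [/\ forall k, rho_measurable f (h k), forall k s, 0 <= h k s <= 1,
      forall k H, l k H = Rintegral mu setT (fun s => maxlin_fun phi H s * h k s) &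
      {ae mu, forall s, \sum_k h k s = 1}].
Proof.
suff hex k : exists h : S -> R, [/\ rho_measurable f h, forall s, 0 <= h s <= 1 &
    forall H, l k H = Rintegral mu setT (fun s => maxlin_fun phi H s * h s)].
  have [h hh] := choice hex; exists h; split; try by move=> k; have [] := hh k.
  have h01 k s : 0 <= h k s <= 1 by have [_ ->] := hh k.
  have mh k : rho_measurable f (h k) by have [] := hh k.
  have ms : rho_measurable f (fun s => \sum_k h k s) by exact: measurable_sum.
  have mhS k : measurable_fun setT (h k) by exact: measurable_fun_gen (mh k).
  have iv H : mu.-integrable setT (EFin \o maxlin_fun phi H) by exact: integrable_maxlin_fun.
  have m1 : rho_measurable f (fun=> 1) by exact: measurable_cst.
  apply: (@density_unique _ _ _ _ _ _ alpha alpha_gt0 f0 mf iphi full _ _ n.+1%:R ms m1).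
  - move=> s; rewrite ger0_norm; last by apply: sumr_ge0 => k _; case/andP: (h01 k s).
    apply: le_trans (_ : \sum_(k < n.+1) 1 <= _).
      by apply: ler_sum => k _; case/andP: (h01 k s).
    by rewrite sumr_const card_ord.
  - by move=> s; rewrite normr1 ler1n.
  move=> H; rewrite (_ : Rintegral _ _ (fun s => maxlin_fun _ H s * 1) = Rintegral mu setT (maxlin_fun phi H));
    last by congr Rintegral; apply/funext => s; rewrite mulr1.
  rewrite -suml.
  have ih k : mu.-integrable setT (EFin \o (fun s => maxlin_fun phi H s * h k s)).
    apply: (integrable_mul_bounded (C := 1) (iv H)) => // s.
    by rewrite ger0_norm; case/andP: (h01 k s).
  transitivity (\sum_k Rintegral mu setT (fun s => maxlin_fun phi H s * h k s)); last first.
    by apply: eq_bigr => k _; have [_ _ ->] := hh k.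
  rewrite -Rintegral_sum//; congr Rintegral; apply/funext => s.
  by rewrite mulr_sumr.
have [t0|T0] := pselect (exists t : T, True).
  have [t _] := t0.
  have [tt htt] := countable_support f0 mf t hmu full.
  exact: (density_exists alpha_gt0 f0 mf iphi htt hl al suml k).
exists (fun=> 1); split; [exact: measurable_cst|by move=> s; rewrite ler01 lexx|].
case=> [|p H]; last by exfalso; apply: T0; exists p.1.
rewrite (alternating_nil (hl k)) (_ : (fun s => _) = cst 0).
  by rewrite /Rintegral integral0.
by apply/funext => s; rewrite /maxlin_fun maxlin_nil mul0r.
Qed.

End densities.

Unset Implicit Arguments.
Set Strict Implicit.
Set Printing Implicit Defensive.

Theorem theorem4p1 (R : realType) (alpha : R)
    (alpha_gt0 : 0 < alpha) (alpha_lt2 : alpha < 2)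
    (T : metricType R) (hT : complete_separable T)
    (dS : measure_display) (S : measurableType dS)
    (mu : {measure set S -> \bar R})
    (hS : standard_borel R S) (hmu : sigma_finite setT mu)
    (f : T -> S -> R) (hf : forall t, Lplus mu alpha (f t))
    (hsupp : full_support mu f)
    (* the extremal integral with respect to the random sup-measure *)
    (dM : measure_display) (OM : measurableType dM) (PM : probability OM R)
    (I : (S -> R) -> OM -> R) (hI : is_extremal_integral mu alpha PM I)
    (* the process Y and its spectral representation *)
    (dY : measure_display) (OY : measurableType dY) (PY : probability OY R)
    (Y : T -> {RV PY >-> R}) (hY : frechet_process PY alpha Y)
    (hrep : eq_fdd PY Y PM (fun t => I (f t)))
    (* the independent processes Y^(0), ..., Y^(n) *)
    (dK : measure_display) (OK : measurableType dK) (PK : probability OK R)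
    (n : nat) (Yk : 'I_n.+1 -> T -> {RV PK >-> R})
    (hYk : forall k, frechet_process PK alpha (Yk k))
    (hind : independent_processes PK (fun k t => Yk k t : OK -> R)) :
  let decomposition :=
    eq_fdd PY Y PK (fun t w => vmax (fun k => Yk k t w)) in
  let unit_valued (r : 'I_n.+1 -> S -> R) :=
    forall k s, 0 <= r k s <= 1 in
  let condR (r : 'I_n.+1 -> S -> R) :=
    forall k, eq_fdd PK (Yk k) PM (fun t => I (fun s => r k s * f t s)) in
  let sum_one (r : 'I_n.+1 -> S -> R) :=
    {ae mu, forall s, \sum_(k < n.+1) r k s `^ alpha = 1} in
  (decomposition <->
   exists r : 'I_n.+1 -> S -> R,
     [/\ forall k, measurable_fun setT (r k), unit_valued r, condR r
       & sum_one r]) /\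
  (decomposition ->
   exists r : 'I_n.+1 -> S -> R,
     [/\ forall k, rho_measurable f (r k), unit_valued r, condR r, sum_one r
       & forall r' : 'I_n.+1 -> S -> R,
           (forall k, rho_measurable f (r' k)) -> unit_valued r' -> condR r' ->
           forall k, {ae mu, forall s, r' k s = r k s}]).
Proof.

move=> decomposition unit_valued condR sum_one.
have f0 t s : 0 <= f t s by case: (hf t).
have mf t : measurable_fun setT (f t) by exact: Lplus_measurable (hf t).
pose phi t s := f t s `^ alpha.
have iphi t : mu.-integrable setT (EFin \o phi t) by exact: Lplus_integrable.
have mYk k t : measurable_fun setT (Yk k t) by [].
have mIf g : Lplus mu alpha g -> measurable_fun setT (I g).
  by move=> Lg; have [h _] := hI; case: (h g Lg).
have Lrf (r : S -> R) t : measurable_fun setT r -> (forall s, 0 <= r s <= 1) ->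
    Lplus mu alpha (fun s => r s * f t s).
  by move=> mr r01; exact: Lplus_scale.
have maxlin_fun_scale (r : S -> R) H : (forall s, 0 <= r s) ->
    maxlin_fun (fun t s => (r s * f t s) `^ alpha) H = (fun s => maxlin_fun phi H s * r s `^ alpha).
  move=> r0; apply/funext => s; rewrite mulrC /maxlin_fun -maxlin_scale ?powR_ge0//.
  by congr maxlin; apply/funext => t; rewrite powRM.
have condR_below (r : 'I_n.+1 -> S -> R) k H : (forall k, measurable_fun setT (r k)) ->
    unit_valued r -> condR r ->
    PK (below (fun t => Yk k t : OK -> R) (thresholds alpha H)) =
      (expR (- Rintegral mu setT (fun s => maxlin_fun phi H s * r k s `^ alpha)))%:E.
  move=> mr r01 hr; rewrite (eq_fdd_below (hr k)).
  rewrite (extremal_below alpha_gt0 hI) ?maxlin_fun_scale//.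
    by move=> s; case/andP: (r01 k s).
  by move=> t; exact: Lrf.
have Y_below H : PY (below (fun t => Y t : OY -> R) (thresholds alpha H)) =
    (expR (- Rintegral mu setT (maxlin_fun phi H)))%:E.
  by rewrite (eq_fdd_below hrep) (extremal_below alpha_gt0 hI).
have main : decomposition -> exists r : 'I_n.+1 -> S -> R,
     [/\ forall k, rho_measurable f (r k), unit_valued r, condR r, sum_one r
       & forall r' : 'I_n.+1 -> S -> R,
           (forall k, rho_measurable f (r' k)) -> unit_valued r' -> condR r' ->
           forall k, {ae mu, forall s, r' k s = r k s}].
  move=> dec.
  have hex k := exponent_exists alpha_gt0 (mYk k) (hYk k).
  have [l hl] := choice hex.
  have lh k : homogeneous (l k) by have [] := hl k.
  have la k : alternating (l k) by have [] := hl k.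
  have lE k H : PK (below (fun t => Yk k t : OK -> R) (thresholds alpha H)) = (expR (- l k H))%:E.
    by have [] := hl k.
  have suml H : \sum_k l k H = Rintegral mu setT (maxlin_fun phi H).
    have := Y_below H; rewrite (eq_fdd_below dec) (independent_below _ hind).
    rewrite (eq_bigr (fun k => (expR (- l k H))%:E)) => [|k _]; last exact: lE.
    rewrite prodEFin -expR_sum => -[/expR_inj].
    by rewrite sumrN => /oppr_inj.
  have [h [mh h01 hlE hsum]] := densities alpha_gt0 f0 mf iphi hmu hsupp lh la suml.
  have hK k s : (h k s `^ alpha^-1) `^ alpha = h k s.
    by rewrite -powRrM mulVf ?gt_eqF// powRr1//; case/andP: (h01 k s).
  pose r k s := h k s `^ alpha^-1.
  have r01 : unit_valued r.
    move=> k s; rewrite powR_ge0 /=; case/andP: (h01 k s) => a b.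
    have a1 : 0 <= alpha^-1 by rewrite invr_ge0 ltW.
    by have := ge0_ler_powR a1 a ler01 b; rewrite powR1.
  have mr k : rho_measurable f (r k).
    exact: (measurableT_comp (measurable_powR alpha^-1) (mh k)).
  have mrS k : measurable_fun setT (r k) by exact: measurable_fun_gen (mr k).
  exists r; split => //.
  - move=> k; apply: eq_fdd_of_below => //.
    + by move=> t; apply: mIf; exact: Lrf.
    + move=> K K0; have [H <-] := thresholds_form alpha_gt0 K0.
      rewrite lE hlE (extremal_below alpha_gt0 hI) ?maxlin_fun_scale//.
      * congr (expR (- _))%:E; congr Rintegral; apply/funext => s.
        by rewrite /r hK.
      * by move=> s; case/andP: (r01 k s).
      * by move=> t; exact: Lrf.
    + by move=> t e e0; exact: (frechet_small alpha_gt0 t (hYk k) e0).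
  - apply: filterS hsum => s <-; apply: eq_bigr => k _; exact: hK.
  move=> r' mr' r'01 hr' k.
  have mr'S k' : measurable_fun setT (r' k') by exact: measurable_fun_gen (mr' k').
  have ma : rho_measurable f (fun s => r' k s `^ alpha).
    exact: (measurableT_comp (measurable_powR alpha) (mr' k)).
  have b1 s : `|r' k s `^ alpha| <= 1.
    rewrite ger0_norm ?powR_ge0//; case/andP: (r'01 k s) => a b.
    by have := ge0_ler_powR (ltW alpha_gt0) a ler01 b; rewrite powR1.
  have b2 s : `|h k s| <= 1 by case/andP: (h01 k s) => a b; rewrite ger0_norm.
  have eqv H : Rintegral mu setT (fun s => maxlin_fun phi H s * r' k s `^ alpha) =
      Rintegral mu setT (fun s => maxlin_fun phi H s * h k s).
    have := condR_below r' k H mr'S r'01 hr'.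
    by rewrite lE hlE => -[/expR_inj /oppr_inj].
  have := density_unique alpha_gt0 f0 mf iphi hsupp ma (mh k) b1 b2 eqv.
  apply: filterS => s e; rewrite /r -e -powRrM mulfV ?gt_eqF// powRr1//.
  by case/andP: (r'01 k s).
split=> //; split.
  move=> /main[r [mr r01 hr sr _]]; exists r; split => // k.
  exact: measurable_fun_gen (mr k).
move=> [r [mr r01 hr sr]].
apply: eq_fdd_of_below => //.
- move=> t; exact: measurable_vmax.
- move=> K K0; have [H <-] := thresholds_form alpha_gt0 K0.
  rewrite Y_below (independent_below _ hind).
  rewrite (eq_bigr (fun k => (expR (- Rintegral mu setT
    (fun s => maxlin_fun phi H s * r k s `^ alpha)))%:E)) => [|k _]; last exact: condR_below.
  have mrS k : measurable_fun setT (fun s => r k s `^ alpha).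
    exact: (measurableT_comp (measurable_powR alpha) (mr k)).
  have iv : mu.-integrable setT (EFin \o maxlin_fun phi H) by exact: integrable_maxlin_fun.
  have ir k : mu.-integrable setT (EFin \o (fun s => maxlin_fun phi H s * r k s `^ alpha)).
    apply: (integrable_mul_bounded (C := 1) iv) => // s.
    rewrite ger0_norm ?powR_ge0//; case/andP: (r01 k s) => a b.
    by have := ge0_ler_powR (ltW alpha_gt0) a ler01 b; rewrite powR1.
  rewrite prodEFin -expR_sum sumrN -Rintegral_sum//.
  congr (expR (- _))%:E; apply: Rintegral_ae_eq.
  + exact: integrable_measurable iv.
  + by apply: measurable_sum => k; exact: integrable_measurable (ir k).
  by apply: filterS sr => s e; rewrite -mulr_sumr e mulr1.
- by move=> t e e0; exact: (frechet_small alpha_gt0 t hY e0).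
Qed.
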